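(* Assume $\sum_{i=1}^n w_i^s=\sum_{j=1}^m w_j^p$. Let $C=N^{2(n+m)}$ (a positive self-adjoint operator on $\mathscr{H}$) and $C_\epsilon=C(1+\epsilon C)^{-2}$. Then there exist $\delta>0$ and constants $b_1,b_2\ge0$ such that: (0) $\mathrm{Dom}(C^{1/2})\subset\mathrm{Dom}(F):=\bigcap_{i,j=0}^d\mathrm{Dom}(F_{ij})$; (a) for each $\epsilon\in(0,\delta)$, with $D_\epsilon:=D$, one has $C_\epsilon^{1/2}D_\epsilon\subset D$ and each operator $F_{ij}^*C_\epsilon^{1/2}|_{D_\epsilon}$ ($0\le i,j\le d$) is bounded; (b) for all $\epsilon\in(0,\delta)$ and all $u_0,\dots,u_d\in\mathrm{Dom}(F)$, $$\sum_{i,j=0}^d\Big(\langle u_i|C_\epsilon F_{ij}u_j\rangle+\langle F_{ji}u_i|C_\epsilon u_j\rangle+\sum_{k=1}^d\langle F_{ki}u_i|C_\epsilon F_{kj}u_j\rangle\Big)\le\sum_{i=0}^d\Big(b_1\langle u_i|C_\epsilon u_i\rangle+b_2\|u_i\|^2\Big).$$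
   Context: Let $n,m\ge1$, $\mathbb{N}=\{0,1,2,\dots\}$, $\mathscr{H}=\bigotimes_{i=1}^{n+m}\ell^2(\mathbb{N})$ with orthonormal basis $e(\mathsf{s},\mathsf{p})=e_{s_1}\otimes\cdots\otimes e_{s_n}\otimes e_{p_1}\otimes\cdots\otimes e_{p_m}$ ($\mathsf{s}\in\mathbb{N}^n,\mathsf{p}\in\mathbb{N}^m$); $D$ is the set of finite linear combinations of these vectors. $a_k,a_k^\dagger$ ($k=1,\dots,n$) and $b_j,b_j^\dagger$ ($j=1,\dots,m$) are the annihilation/creation operators on the $k$-th, resp. $(n+j)$-th factor ($a_k e(\mathsf{s},\mathsf{p})=\sqrt{s_k}e(\mathsf{s}-\delta_k,\mathsf{p})$, $a_k^\dagger e(\mathsf{s},\mathsf{p})=\sqrt{s_k+1}e(\mathsf{s}+\delta_k,\mathsf{p})$, analogously for $b_j,b_j^\dagger$ on $\mathsf{p}$). Frequencies $w_i^s>0$, $w_j^p>0$. $N_s=\sum_i w_i^s a_i^\dagger a_i$, $N_p=\sum_j w_j^p b_j^\dagger b_j$, $N=N_s+N_p$ (self-adjoint, diagonal in the basis). $I=\prod_{i=1}^n a_i^\dagger\prod_{j=1}^m b_j-\prod_{i=1}^n a_i\prod_{j=1}^m b_j^\dagger$, $H=N_s+N_p+\frac{\mathrm{i}g}{2}I$ with $g$ a nonzero real constant. Channel operators, with arbitrary complex constants $\alpha^{(l)}_i$: $R^{(1)}_i=\alpha^{(1)}_ia_i$, $R^{(3)}_i=\alpha^{(3)}_ia_i$,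 $R^{(5)}_i=\alpha^{(5)}_ia_i$, $R^{(7)}_i=\alpha^{(7)}_ia_i^\dagger$ ($i=1,\dots,n$), $R^{(2)}_j=\alpha^{(2)}_jb_j$, $R^{(4)}_j=\alpha^{(4)}_jb_j$, $R^{(6)}_j=\alpha^{(6)}_jb_j$, $R^{(8)}_j=\alpha^{(8)}_jb_j^\dagger$ ($j=1,\dots,m$). Let $d=4(n+m)$ and let $R_1,\dots,R_d$ be an enumeration of these $d$ channel operators; $R=\sum_{i=1}^dR_i^*R_i$ and $K=-\mathrm{i}H-\frac12R$. The coefficient matrix $F=(F_{ij})_{0\le i,j\le d}$ is: $F_{00}=K$, $F_{i0}=R_i$, $F_{0j}=N_j:=-R_j^*$, and $F_{ij}=0$ for $i,j\ge1$; each $F_{ij}$ is understood as the closure of its restriction to $D$, and $F_{ij}^*$ denotes the adjoint. *)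

(* Defs.v *)
From Stdlib Require Import Reals ClassicalEpsilon.
From mathcomp Require Import all_boot.

Set Implicit Arguments.
Unset Strict Implicit.
Unset Printing Implicit Defensive.

Local Open Scope R_scope.

Record Cx := mkC { Re : R; Im : R }.
Definition C0 : Cx := mkC 0 0.
Definition CofR (r : R) : Cx := mkC r 0.
Definition Cadd (z w : Cx) : Cx := mkC (Re z + Re w) (Im z + Im w).
Definition Copp (z : Cx) : Cx := mkC (- Re z) (- Im z).
Definition Cmul (z w : Cx) : Cx :=
  mkC (Re z * Re w - Im z * Im w) (Re z * Im w + Im z * Re w).
Definition Cconj (z : Cx) : Cx := mkC (Re z) (- Im z).
Definition Cnorm2 (z : Cx) : R := Re z * Re z + Im z * Im z.
Definition Ci : Cx := mkC 0 1.

Definition fsumR (T : finType) (f : T -> R) : R :=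
  foldr (fun t acc => f t + acc) 0 (enum T).
Definition fsumC (T : finType) (f : T -> Cx) : Cx :=
  foldr (fun t acc => Cadd (f t) acc) C0 (enum T).

Section L2.
Variable X : Type.
Definition Vec := X -> Cx.

Definition lsum (f : X -> R) (l : seq X) : R := foldr (fun x acc => f x + acc) 0 l.

(* sum of a nonnegative family = sup of its finite partial sums *)
Definition psum (f : X -> R) : R :=
  epsilon (inhabits 0)
    (fun r => is_lub (fun y => exists l : seq X, List.NoDup l /\ y = lsum f l) r).
Definition sums_bounded (f : X -> R) : Prop :=
  exists M, forall l : seq X, List.NoDup l -> lsum f l <= M.
Definition sumR (f : X -> R) : R :=
  psum (fun x => Rmax (f x) 0) - psum (fun x => Rmax (- f x) 0).
Definition sumC (f : X -> Cx) : Cx :=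
  mkC (sumR (fun x => Re (f x))) (sumR (fun x => Im (f x))).

Definition inL2 (u : Vec) : Prop := sums_bounded (fun x => Cnorm2 (u x)).
(* physics convention: antilinear in the first slot *)
Definition inner (u v : Vec) : Cx := sumC (fun x => Cmul (Cconj (u x)) (v x)).
Definition norm (u : Vec) : R := sqrt (psum (fun x => Cnorm2 (u x))).

Definition vzero : Vec := fun _ => C0.
Definition vadd (u v : Vec) : Vec := fun x => Cadd (u x) (v x).
Definition vscal (a : Cx) (u : Vec) : Vec := fun x => Cmul a (u x).
Definition vsub (u v : Vec) : Vec := vadd u (vscal (CofR (-1)) v).
Definition mul_diag (c : X -> R) (u : Vec) : Vec := fun x => Cmul (CofR (c x)) (u x).

Definition conv (uk : nat -> Vec) (u : Vec) : Prop :=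
  Un_cv (fun k => norm (vsub (uk k) u)) 0.

(* D : finite linear combinations of basis vectors = finitely supported *)
Definition inD (u : Vec) : Prop :=
  exists l : seq X, forall x, ~ List.In x l -> u x = C0.

Record Op := mkOp { dom : Vec -> Prop; app : Vec -> Vec }.

Definition restrD (A : Vec -> Vec) : Op := mkOp inD A.
Definition restrict_D (T : Op) : Op := mkOp (fun u => inD u /\ dom T u) (app T).
Definition op_add (T S : Op) : Op :=
  mkOp (fun u => dom T u /\ dom S u) (fun u => vadd (app T u) (app S u)).
Definition op_scal (a : Cx) (T : Op) : Op := mkOp (dom T) (fun u => vscal a (app T u)).
Definition op_comp (T S : Op) : Op :=
  mkOp (fun u => dom S u /\ dom T (app S u)) (fun u => app T (app S u)).
Definition op_zero : Op := mkOp (fun _ => True) (fun _ => vzero).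

Definition closure_graph (T : Op) (u v : Vec) : Prop :=
  inL2 u /\ inL2 v /\
  exists uk : nat -> Vec, (forall k, dom T (uk k)) /\ conv uk u /\
                         conv (fun k => app T (uk k)) v.
Definition closure (T : Op) : Op :=
  mkOp (fun u => exists v, closure_graph T u v)
       (fun u => epsilon (inhabits vzero) (fun v => closure_graph T u v)).

Definition adjoint_graph (T : Op) (v w : Vec) : Prop :=
  inL2 v /\ inL2 w /\ forall u, dom T u -> inner v (app T u) = inner w u.
Definition adjoint (T : Op) : Op :=
  mkOp (fun v => exists w, adjoint_graph T v w)
       (fun v => epsilon (inhabits vzero) (fun w => adjoint_graph T v w)).
End L2.

Definition Idx (n m : nat) : Type := (('I_n -> nat) * ('I_m -> nat))%type.

Definition upd (k : nat) (s : 'I_k -> nat) (i : 'I_k) (f : nat -> nat) : 'I_k -> nat :=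
  fun j => if j == i then f (s j) else s j.

Section Model.
Variables (n m : nat).
Local Notation V := (Vec (Idx n m)).

(* a_k e(s,p) = sqrt(s_k) e(s - d_k, p), a_k^dag e(s,p) = sqrt(s_k+1) e(s + d_k, p),
   written on coefficient functions u : Idx -> C *)
Definition ann_a (k : 'I_n) (u : V) : V :=
  fun x => Cmul (CofR (sqrt (INR (x.1 k).+1))) (u (upd x.1 k S, x.2)).
Definition cre_a (k : 'I_n) (u : V) : V :=
  fun x => Cmul (CofR (sqrt (INR (x.1 k)))) (u (upd x.1 k predn, x.2)).
Definition ann_b (k : 'I_m) (u : V) : V :=
  fun x => Cmul (CofR (sqrt (INR (x.2 k).+1))) (u (x.1, upd x.2 k S)).
Definition cre_b (k : 'I_m) (u : V) : V :=
  fun x => Cmul (CofR (sqrt (INR (x.2 k)))) (u (x.1, upd x.2 k predn)).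

Definition prod_ops (l : seq (V -> V)) : V -> V :=
  foldr (fun A acc => fun u => A (acc u)) id l.

Definition Iform (u : V) : V :=
  vsub (prod_ops (map cre_a (enum 'I_n)) (prod_ops (map ann_b (enum 'I_m)) u))
       (prod_ops (map ann_a (enum 'I_n)) (prod_ops (map cre_b (enum 'I_m)) u)).

Variables (ws : 'I_n -> R) (wp : 'I_m -> R) (g : R).

(* eigenvalue of N = N_s + N_p on e(s,p) *)
Definition Nval (x : Idx n m) : R :=
  fsumR (fun i => ws i * INR (x.1 i)) + fsumR (fun j => wp j * INR (x.2 j)).

Definition Hop : Op (Idx n m) :=
  restrD (fun u => vadd (mul_diag Nval u) (vscal (mkC 0 (g / 2)) (Iform u))).

(* channels: (l, i) with l in {0,1,2,3} <-> R^(1),R^(3),R^(5),R^(7) on a_i,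
   and (l, j) <-> R^(2),R^(4),R^(6),R^(8) on b_j *)
Definition chan : finType := (('I_4 * 'I_n) + ('I_4 * 'I_m))%type.

Definition chan_op (c : chan) : V -> V :=
  match c with
  | inl (l, i) => if nat_of_ord l == 3%N then cre_a i else ann_a i
  | inr (l, j) => if nat_of_ord l == 3%N then cre_b j else ann_b j
  end.

Variable alpha : chan -> Cx.

Definition Rop (c : chan) : Op (Idx n m) := restrD (fun u => vscal (alpha c) (chan_op c u)).
Definition Rstar (c : chan) : Op (Idx n m) := adjoint (closure (Rop c)).
Definition Rsum : Op (Idx n m) :=
  foldr (fun c acc => op_add (op_comp (Rstar c) (Rop c)) acc) (op_zero _) (enum chan).
Definition Kop : Op (Idx n m) :=
  op_add (op_scal (Copp Ci) Hop) (op_scal (CofR (-1/2)) Rsum).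

(* F_{ij}, indices 0..d encoded as option chan (None = 0); each entry is the
   closure of its restriction to D *)
Definition Fop (i j : option chan) : Op (Idx n m) :=
  match i, j with
  | None, None => closure (restrict_D Kop)
  | Some c, None => closure (restrict_D (Rop c))
  | None, Some c => closure (restrict_D (op_scal (CofR (-1)) (Rstar c)))
  | Some _, Some _ => closure (restrD (fun _ : V => @vzero (Idx n m)))
  end.

Definition inDomF (u : V) : Prop := forall i j, dom (Fop i j) u.

Definition Cval (x : Idx n m) : R := Nval x ^ (2 * (n + m))%N.
Definition Cepsval (eps : R) (x : Idx n m) : R := Cval x / (1 + eps * Cval x) ^ 2.
Definition inDomChalf (u : V) : Prop :=
  inL2 u /\ inL2 (mul_diag (fun x => sqrt (Cval x)) u).

Definition lhsB (eps : R) (u : option chan -> V) : Cx :=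
  fsumC (fun i => fsumC (fun j =>
    Cadd (Cadd (inner (u i) (mul_diag (Cepsval eps) (app (Fop i j) (u j))))
               (inner (app (Fop j i) (u i)) (mul_diag (Cepsval eps) (u j))))
         (fsumC (fun k : chan =>
            inner (app (Fop (Some k) i) (u i))
                  (mul_diag (Cepsval eps) (app (Fop (Some k) j) (u j))))))).
End Model.

(* Main.v *)
Require Import Defs.
From Stdlib Require Import Reals ClassicalEpsilon FunctionalExtensionality PropExtensionality Psatz.
From mathcomp Require Import all_boot.
Local Open Scope R_scope.

Set Implicit Arguments.
Unset Strict Implicit.
Unset Printing Implicit Defensive.

(** Each entry [F_ij] acts on the basis coefficients as a finite sum of weighted shifts
    [u |-> (x |-> c x * u (sg x))] which change the energy [N] by a constant and whose squared
    weights grow polynomially in [N].  Such operators are controlled by powers of [1 + N], which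
    gives (0) and (a).  For (b), [C_eps] damps every polynomial weight, so all the sums converge
    absolutely and can be reindexed.  As the two frequency sums agree, the interaction conserves
    [N], hence the Hamiltonian part drops out; what remains are differences of [C_eps] along the
    shifts of the channels, and [C_eps] varies slowly:
    [|C_eps(t') - C_eps(t)| (1 + t) <= K (1 + C_eps(t))] for [|t' - t| <= d], with [K] independent
    of [eps]. *)

(** * Sums over arbitrary index types *)

(** Closures and adjoints take their values by [epsilon], so each value must first be pinned down.
    Convergence in norm forces convergence of every coordinate, and all basis vectors lie in [D];
    hence both graphs are functional, and the explicit formula holds on all of Dom(F), with no
    approximation argument in (b). On Dom(F) only the whole sum of shifts is known to be square
    summable, not its single terms: splitting [<C_eps u | K u>] into terms is legitimate because
    [C_eps (1 + N)^p] is bounded for [p = 2(n+m)], and [p] dominates the degree [n+m] of the squared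
    weights of the interaction and the degree 2 of those of [N] and of the damping. That bound
    depends on [eps], which is harmless, since it serves (a) and summability only. The constants of
    (b) come from slow variation alone. The factor [1 + t] there pays for the squared weight of a
    channel, which has degree 1 in [N]; a difference of [C_eps] over a bounded step gains exactly
    that degree. *)

Section Sums.
Variable X : Type.
Implicit Types (f g : X -> R) (l : seq X).

Lemma lsum_ge0 f l : (forall x, 0 <= f x) -> 0 <= lsum f l.
Proof. by move=> h; elim: l => [|x l IH] /=; [lra | have := h x; lra]. Qed.

Lemma lsum_le f g l : (forall x, f x <= g x) -> lsum f l <= lsum g l.
Proof. by move=> h; elim: l => [|x l IH] /=; [lra | have := h x; lra]. Qed.

Lemma lsum_eq_in f g l : (forall x, List.In x l -> f x = g x) -> lsum f l = lsum g l.
Proof.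
elim: l => [|x l IH] h //=; rewrite IH ?(h x) //; first by left.
by move=> y hy; apply: h; right.
Qed.

Lemma lsum_add f g l : lsum (fun x => f x + g x) l = lsum f l + lsum g l.
Proof. by elim: l => [|x l IH] /=; [lra | rewrite IH; lra]. Qed.

Lemma lsum_scal a f l : lsum (fun x => a * f x) l = a * lsum f l.
Proof. by elim: l => [|x l IH] /=; [lra | rewrite IH; lra]. Qed.

Lemma lsum_cat f l1 l2 : lsum f (l1 ++ l2) = lsum f l1 + lsum f l2.
Proof. by elim: l1 => [|x l IH] /=; [lra | rewrite IH; lra]. Qed.

Lemma lsum_incl f l1 l2 : (forall x, 0 <= f x) -> List.NoDup l1 -> List.incl l1 l2 ->
  lsum f l1 <= lsum f l2.
Proof.
move=> f0; elim: l1 l2 => [|x l1 IH] l2 nd inc /=; first exact: lsum_ge0.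
have [nx nd1] : ~ List.In x l1 /\ List.NoDup l1 by move/List.NoDup_cons_iff: nd.
have xl2 : List.In x l2 by apply: inc; left.
have [s [t el2]] := List.in_split _ _ xl2.
have inc' : List.incl l1 (s ++ t).
  move=> y yl1; have := inc y (or_intror yl1).
  rewrite el2 => /(List.in_app_or s) [?|[exy|?]]; apply: List.in_or_app; auto.
  by rewrite -exy in yl1.
by have := IH _ nd1 inc'; rewrite el2 !lsum_cat /=; lra.
Qed.

Lemma exists_NoDup_union l1 l2 :
  exists l, [/\ List.NoDup l, List.incl l1 l & List.incl l2 l].
Proof.
exists (List.nodup (fun x y => excluded_middle_informative (x = y)) (l1 ++ l2)).
by split; [exact: List.NoDup_nodup | |] => x hx; apply/List.nodup_In;
  apply: List.in_or_app; auto.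
Qed.

Lemma psum_lub f : sums_bounded f ->
  is_lub (fun y => exists l : seq X, List.NoDup l /\ y = lsum f l) (psum f).
Proof.
move=> [M hM]; rewrite /psum; apply: epsilon_spec.
case: (completeness (fun y => exists l : seq X, List.NoDup l /\ y = lsum f l)).
- by exists M => y [l [nd ->]]; exact: hM.
- by exists 0, [::]; split => //; constructor.
- by move=> r hr; exists r.
Qed.

Lemma lsum_le_psum f l : sums_bounded f -> List.NoDup l -> lsum f l <= psum f.
Proof. by move=> /psum_lub [ub _] nd; apply: ub; exists l. Qed.

Lemma psum_le_bound f M : (forall l, List.NoDup l -> lsum f l <= M) -> psum f <= M.
Proof.
move=> h; have /psum_lub [_ lub] : sums_bounded f by exists M.
by apply: lub => y [l [nd ->]]; exact: h.
Qed.

Lemma psum_ge0 f : sums_bounded f -> 0 <= psum f.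
Proof. by move=> bf; apply: (@lsum_le_psum f [::]) => //; constructor. Qed.

Lemma term_le_psum f x : sums_bounded f -> f x <= psum f.
Proof.
move=> bf; have := @lsum_le_psum f [:: x] bf; rewrite /= Rplus_0_r; apply.
by constructor => //; constructor.
Qed.

Lemma sums_bounded_le f g : (forall x, f x <= g x) -> sums_bounded g -> sums_bounded f.
Proof.
move=> h [M hM]; exists M => l nd.
exact: (Rle_trans _ _ _ (lsum_le l h) (hM l nd)).
Qed.

Lemma sums_bounded_add f g :
  sums_bounded f -> sums_bounded g -> sums_bounded (fun x => f x + g x).
Proof.
move=> [M hM] [M' hM']; exists (M + M') => l nd; rewrite lsum_add.
by have := hM l nd; have := hM' l nd; lra.
Qed.

Lemma sums_bounded_scal a f :
  0 <= a -> sums_bounded f -> sums_bounded (fun x => a * f x).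
Proof.
move=> a0 [M hM]; exists (a * M) => l nd; rewrite lsum_scal.
exact: Rmult_le_compat_l (hM l nd).
Qed.

Lemma psum_le f g : (forall x, f x <= g x) -> sums_bounded g -> psum f <= psum g.
Proof.
move=> h bg; apply: psum_le_bound => l nd.
exact: (Rle_trans _ _ _ (lsum_le l h) (lsum_le_psum bg nd)).
Qed.

Lemma psum_add f g : (forall x, 0 <= f x) -> (forall x, 0 <= g x) ->
  sums_bounded f -> sums_bounded g -> psum (fun x => f x + g x) = psum f + psum g.
Proof.
move=> f0 g0 bf bg; apply: Rle_antisym.
  apply: psum_le_bound => l nd; rewrite lsum_add.
  by have := lsum_le_psum bf nd; have := lsum_le_psum bg nd; lra.
have bfg := sums_bounded_add bf bg.
(* Superadditivity takes the two suprema one after the other; two finite lists are compared through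
   a common duplicate-free list. *)
suff : psum f <= psum (fun x => f x + g x) - psum g by lra.
apply: psum_le_bound => l1 nd1.
suff : psum g <= psum (fun x => f x + g x) - lsum f l1 by lra.
apply: psum_le_bound => l2 nd2.
have [l [nd i1 i2]] := exists_NoDup_union l1 l2.
have := lsum_le_psum bfg nd; rewrite lsum_add.
by have := lsum_incl f0 nd1 i1; have := lsum_incl g0 nd2 i2; lra.
Qed.

Lemma psum_scal a f : 0 <= a -> sums_bounded f -> psum (fun x => a * f x) = a * psum f.
Proof.
move=> a0 bf; apply: Rle_antisym.
  apply: psum_le_bound => l nd; rewrite lsum_scal.
  exact: Rmult_le_compat_l (lsum_le_psum bf nd).
case: (Rle_lt_or_eq_dec _ _ a0) => [apos | <-]; last first.
  by rewrite Rmult_0_l; apply: psum_ge0; apply: sums_bounded_scal => //; lra.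
have baf := sums_bounded_scal a0 bf.
suff : psum f <= / a * psum (fun x => a * f x).
  move=> /(Rmult_le_compat_l _ _ _ a0); rewrite -Rmult_assoc Rinv_r; lra.
apply: psum_le_bound => l nd.
have -> : lsum f l = / a * lsum (fun x => a * f x) l.
  by rewrite lsum_scal; field; lra.
apply: Rmult_le_compat_l; last exact: lsum_le_psum.
by left; apply: Rinv_0_lt_compat.
Qed.

Lemma psum_zero : psum (fun _ : X => 0) = 0.
Proof.
have h0 l : lsum (fun _ : X => 0) l = 0 by elim: l => //= x l ->; lra.
apply: Rle_antisym; first by apply: psum_le_bound => l _; rewrite h0; lra.
by apply: psum_ge0; exists 0 => l _; rewrite h0; lra.
Qed.

(* Matching partial bijections between the supports: the sets of finite partial sums are
   then the same, so no summability is needed for the reindexing. *)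
Definition matched (V : Type) (v0 : V) (sg tu : X -> X) (f g : X -> V) :=
  (forall x, f x <> v0 -> g (sg x) = f x /\ tu (sg x) = x) /\
  (forall y, g y <> v0 -> f (tu y) = g y /\ sg (tu y) = y).

Lemma lsum_matched sg tu f g : matched 0 sg tu f g ->
  forall l, List.NoDup l -> exists l', List.NoDup l' /\ lsum f l = lsum g l'.
Proof.
move=> [h _] l nd.
(* The induction also records that [tu] sends the new list back into the old one; this keeps [sg x]
   from occurring twice. *)
suff [l' [nd' [e hin]]] : exists l', List.NoDup l' /\ lsum f l = lsum g l' /\
    (forall y, List.In y l' -> List.In (tu y) l).
  by exists l'.
elim: l nd => [|x l IH] nd.
  by exists [::]; split; [constructor|].
have [nx nd1] : ~ List.In x l /\ List.NoDup l by move/List.NoDup_cons_iff: nd.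
have [l' [nd' [e hin]]] := IH nd1.
case: (excluded_middle_informative (f x = 0)) => [fx0|/h [gfx tsx]].
  exists l'; split=> //; split; first by rewrite /= fx0 e; lra.
  by move=> y /hin; right.
exists (sg x :: l'); split.
  by constructor => // /hin; rewrite tsx.
split; first by rewrite /= gfx e.
by move=> y /= [<-|/hin]; [left | right].
Qed.

Lemma matched_sym (V : Type) (v0 : V) sg tu (f g : X -> V) :
  matched v0 sg tu f g -> matched v0 tu sg g f.
Proof. by case. Qed.

Lemma psum_matched sg tu f g : matched 0 sg tu f g -> psum f = psum g.
Proof.
move=> h; rewrite /psum.
suff -> : (fun y => exists l : seq X, List.NoDup l /\ y = lsum f l) =
          (fun y => exists l : seq X, List.NoDup l /\ y = lsum g l) by [].
apply: functional_extensionality => y; apply: propositional_extensionality.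
split=> - [l [nd ->]].
  by have [l' [nd' e]] := lsum_matched h nd; exists l'.
by have [l' [nd' e]] := lsum_matched (matched_sym h) nd; exists l'.
Qed.

Lemma sums_bounded_matched sg tu f g : matched 0 sg tu f g ->
  sums_bounded g -> sums_bounded f.
Proof.
move=> h [M hM]; exists M => l nd.
by have [l' [nd' ->]] := lsum_matched h nd; exact: hM.
Qed.

Lemma matched_comp (V W : Type) (v0 : V) (w0 : W) (h : V -> W) sg tu (f g : X -> V) :
  h v0 = w0 -> matched v0 sg tu f g ->
  matched w0 sg tu (fun x => h (f x)) (fun x => h (g x)).
Proof.
move=> h0 [H1 H2]; split=> x hx.
  by case: (H1 x) => [e|-> ->] //; apply: hx; rewrite e.
by case: (H2 x) => [e|-> ->] //; apply: hx; rewrite e.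
Qed.

Lemma sumR_matched sg tu f g : matched 0 sg tu f g -> sumR f = sumR g.
Proof.
move=> h; rewrite /sumR; congr (_ - _).
  by apply: psum_matched; apply: (matched_comp (h := fun r => Rmax r 0)) h; rewrite Rmax_left; lra.
by apply: psum_matched; apply: (matched_comp (h := fun r => Rmax (- r) 0)) h; rewrite Rmax_left; lra.
Qed.

Definition summ f := sums_bounded (fun x => Rabs (f x)).

Lemma summ_le f g : (forall x, Rabs (f x) <= g x) -> sums_bounded g -> summ f.
Proof. exact: sums_bounded_le. Qed.

Lemma summ_add f g : summ f -> summ g -> summ (fun x => f x + g x).
Proof.
move=> sf sg; apply: summ_le (sums_bounded_add sf sg) => x; exact: Rabs_triang.
Qed.

Lemma summ_scal a f : summ f -> summ (fun x => a * f x).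
Proof.
move=> sf; apply: summ_le (sums_bounded_scal (Rabs_pos a) sf) => x.
by rewrite Rabs_mult; lra.
Qed.

Lemma posneg_parts r :
  [/\ 0 <= Rmax r 0, 0 <= Rmax (- r) 0, r = Rmax r 0 - Rmax (- r) 0,
      Rmax r 0 <= Rabs r & Rmax (- r) 0 <= Rabs r].
Proof.
by split; rewrite /Rmax /Rabs; repeat case: Rle_dec => ?; repeat case: Rcase_abs => ?; lra.
Qed.

Lemma summ_parts f : summ f ->
  sums_bounded (fun x => Rmax (f x) 0) /\ sums_bounded (fun x => Rmax (- f x) 0).
Proof.
by move=> sf; split; apply: sums_bounded_le sf => x; case: (posneg_parts (f x)).
Qed.

(** Frees [sumR] from the particular positive and negative parts in its definition; additivity and
    scaling then follow by choosing convenient [p] and [q]. *)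
Lemma sumR_diff f p q : (forall x, 0 <= p x) -> (forall x, 0 <= q x) ->
  sums_bounded p -> sums_bounded q -> (forall x, f x = p x - q x) ->
  sumR f = psum p - psum q.
Proof.
move=> p0 q0 bp bq e.
have sf : summ f.
  apply: summ_le (sums_bounded_add bp bq) => x; rewrite e.
  by have := p0 x; have := q0 x; rewrite /Rabs; case: Rcase_abs => ?; lra.
have [b1 b2] := summ_parts sf.
rewrite /sumR.
(* Moving the subtracted parts across leaves nonnegative summands on both sides, so [psum_add]
   applies. *)
have : psum (fun x => Rmax (f x) 0 + q x) = psum (fun x => Rmax (- f x) 0 + p x).
  congr psum; apply: functional_extensionality => x.
  by have [_ _ h _ _] := posneg_parts (f x); have := e x; lra.
by rewrite !psum_add //; [lra| |] => x; case: (posneg_parts (f x)).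
Qed.

Lemma sumR_ge0E f : (forall x, 0 <= f x) -> sums_bounded f -> sumR f = psum f.
Proof.
move=> f0 bf; rewrite (@sumR_diff f f (fun=> 0)) //; try by move=> x; lra.
- by rewrite psum_zero; lra.
- by apply: sums_bounded_le bf.
Qed.

Lemma sumR_add f g : summ f -> summ g -> sumR (fun x => f x + g x) = sumR f + sumR g.
Proof.
move=> sf sg; have [f1 f2] := summ_parts sf; have [g1 g2] := summ_parts sg.
have P := posneg_parts.
rewrite (@sumR_diff _ (fun x => Rmax (f x) 0 + Rmax (g x) 0)
                      (fun x => Rmax (- f x) 0 + Rmax (- g x) 0)).
- rewrite !psum_add /sumR; try by move=> //.
  all: try by move=> x; case: (P (f x)).
  all: try by move=> x; case: (P (g x)).
  lra.
- by move=> x; case: (P (f x)); case: (P (g x)) => *; lra.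
- by move=> x; case: (P (f x)); case: (P (g x)) => *; lra.
- exact: sums_bounded_add.
- exact: sums_bounded_add.
- by move=> x; case: (P (f x)); case: (P (g x)) => *; lra.
Qed.

Lemma sumR_scal a f : summ f -> sumR (fun x => a * f x) = a * sumR f.
Proof.
move=> sf; have [f1 f2] := summ_parts sf.
have P := posneg_parts.
case: (Rle_lt_dec 0 a) => ha.
  rewrite (@sumR_diff _ (fun x => a * Rmax (f x) 0) (fun x => a * Rmax (- f x) 0)).
  - by rewrite !psum_scal // /sumR Rmult_minus_distr_l.
  - by move=> x; case: (P (f x)) => h1 h2 _ _ _; apply: Rmult_le_pos.
  - by move=> x; case: (P (f x)) => h1 h2 _ _ _; apply: Rmult_le_pos.
  - exact: sums_bounded_scal.
  - exact: sums_bounded_scal.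
  - by move=> x; case: (P (f x)) => _ _ h _ _; rewrite [X in a * X]h; ring.
have ha' : 0 <= - a by lra.
rewrite (@sumR_diff _ (fun x => - a * Rmax (- f x) 0) (fun x => - a * Rmax (f x) 0)).
- by rewrite !psum_scal // /sumR; ring.
- by move=> x; case: (P (f x)) => h1 h2 _ _ _; apply: Rmult_le_pos.
- by move=> x; case: (P (f x)) => h1 h2 _ _ _; apply: Rmult_le_pos.
- exact: sums_bounded_scal.
- exact: sums_bounded_scal.
- by move=> x; case: (P (f x)) => _ _ h _ _; rewrite [X in a * X]h; ring.
Qed.

Lemma sumR_sub f g : summ f -> summ g -> sumR (fun x => f x - g x) = sumR f - sumR g.
Proof.
move=> sf sg.
have -> : (fun x => f x - g x) = (fun x => f x + -1 * g x).
  by apply: functional_extensionality => x; ring.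
by rewrite sumR_add ?sumR_scal //; [ring | exact: summ_scal].
Qed.

Lemma sumR_le_psum f g : summ f -> (forall x, f x <= g x) -> (forall x, 0 <= g x) ->
  sums_bounded g -> sumR f <= psum g.
Proof.
move=> sf le g0 bg; have [b1 b2] := summ_parts sf.
have h1 : psum (fun x => Rmax (f x) 0) <= psum g.
  by apply: psum_le => // x; apply: Rmax_lub.
by have := psum_ge0 b2; rewrite /sumR; lra.
Qed.

Lemma sums_bounded_finsupp f l : (forall x, 0 <= f x) ->
  (forall x, ~ List.In x l -> f x = 0) -> sums_bounded f.
Proof.
move=> f0 fl; exists (lsum f l) => l1 nd1.
pose s := List.filter (fun x => if excluded_middle_informative (List.In x l) then true else false) l1.
have -> : lsum f l1 = lsum f s.
  rewrite /s; elim: l1 {nd1 s} => [|x l1 IH] //=.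
  by case: excluded_middle_informative => [_|/fl ->] /=; rewrite IH; lra.
apply: lsum_incl => //; first exact: List.NoDup_filter.
by move=> x /List.filter_In []; case: excluded_middle_informative.
Qed.

Lemma summ_finsupp f l : (forall x, ~ List.In x l -> f x = 0) -> summ f.
Proof.
move=> fl; apply: (@sums_bounded_finsupp _ l) => [x|x /fl ->]; [exact: Rabs_pos | exact: Rabs_R0].
Qed.

Lemma psum_single f x0 : (forall x, 0 <= f x) -> (forall x, x <> x0 -> f x = 0) ->
  psum f = f x0.
Proof.
move=> f0 fx.
have bf : sums_bounded f.
  by apply: (@sums_bounded_finsupp _ [:: x0]) => // x nx; apply: fx => e; apply: nx; left.
apply: Rle_antisym; last exact: term_le_psum.
apply: psum_le_bound => l nd.
have [nin|yin] : (~ List.In x0 l) \/ List.In x0 l by case: (classic (List.In x0 l)); auto.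
  have -> : lsum f l = 0; last exact: f0.
  elim: l nin {nd} => //= x l IH nin; rewrite IH ?fx; [lra| |].
    by move=> e; apply: nin; left.
  by move=> h; apply: nin; right.
have [s [t el]] := List.in_split _ _ yin; subst l.
have := List.NoDup_remove_2 _ _ _ nd => nin.
have z l : ~ List.In x0 l -> lsum f l = 0.
  elim: l => //= x l IH ni; rewrite IH ?fx; [lra| |].
    by move=> e; apply: ni; left.
  by move=> h; apply: ni; right.
rewrite lsum_cat /= !z; first lra; move=> h; apply: nin; apply: List.in_or_app; auto.
Qed.

Lemma sumR_single f x0 : (forall x, x <> x0 -> f x = 0) -> sumR f = f x0.
Proof.
move=> fx; have P := posneg_parts.
rewrite /sumR !(@psum_single _ x0); first by case: (P (f x0)).
all: move=> x; try (by case: (P (f x))); move=> /fx ->; rewrite ?Ropp_0 Rmax_left; lra.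
Qed.

Lemma sumR_zero : sumR (fun _ : X => 0) = 0.
Proof.
have b0 : sums_bounded (fun _ : X => 0).
  by apply: (@sums_bounded_finsupp _ [::]) => // x; lra.
by rewrite sumR_ge0E ?psum_zero // => x; lra.
Qed.

End Sums.

(** * Square-summable vectors *)

Lemma Cx_eq z w : Re z = Re w -> Im z = Im w -> z = w.
Proof. by case: z => a b; case: w => c d /= -> ->. Qed.

Ltac cx := apply: Cx_eq => /=; ring.
Ltac vx := apply: functional_extensionality => ?; apply: Cx_eq => /=; ring.

Lemma Cnorm2_ge0 z : 0 <= Cnorm2 z.
Proof. by rewrite /Cnorm2; nra. Qed.

Lemma Cnorm2_mul z w : Cnorm2 (Cmul z w) = Cnorm2 z * Cnorm2 w.
Proof. by rewrite /Cnorm2 /=; ring. Qed.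

Lemma Cnorm2_add z w : Cnorm2 (Cadd z w) <= 2 * Cnorm2 z + 2 * Cnorm2 w.
Proof.
case: z w => a b [c d]; rewrite /Cnorm2 /=.
by have := Rle_0_sqr (a - c); have := Rle_0_sqr (b - d); rewrite /Rsqr; lra.
Qed.

Lemma Cnorm2_CofR r : Cnorm2 (CofR r) = r * r.
Proof. by rewrite /Cnorm2 /=; ring. Qed.

Lemma Cnorm2_C0 : Cnorm2 C0 = 0.
Proof. by rewrite /Cnorm2 /=; ring. Qed.

Lemma Re_conj_mul_bound z w : Rabs (Re (Cmul (Cconj z) w)) <= (Cnorm2 z + Cnorm2 w) / 2.
Proof.
case: z w => a b [c d]; rewrite /Cnorm2 /=.
have := Rle_0_sqr (a - c); have := Rle_0_sqr (b - d); have := Rle_0_sqr (a + c).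
have := Rle_0_sqr (b + d); have := Rle_0_sqr (a - d); have := Rle_0_sqr (b - c).
have := Rle_0_sqr (a + d); have := Rle_0_sqr (b + c).
by rewrite /Rsqr => *; apply: Rabs_le; split; lra.
Qed.

Lemma Im_conj_mul_bound z w : Rabs (Im (Cmul (Cconj z) w)) <= (Cnorm2 z + Cnorm2 w) / 2.
Proof.
case: z w => a b [c d]; rewrite /Cnorm2 /=.
have := Rle_0_sqr (a - c); have := Rle_0_sqr (b - d); have := Rle_0_sqr (a + c).
have := Rle_0_sqr (b + d); have := Rle_0_sqr (a - d); have := Rle_0_sqr (b - c).
have := Rle_0_sqr (a + d); have := Rle_0_sqr (b + c).
by rewrite /Rsqr => *; apply: Rabs_le; split; lra.
Qed.

(** * Inner products, finitely supported vectors and coordinatewise limits *)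

Section ComplexSums.
Variable X : Type.
Implicit Types (f g : X -> Cx) (u v w : Vec X).

Definition summC f := summ (fun x => Re (f x)) /\ summ (fun x => Im (f x)).

Lemma summC_add f g : summC f -> summC g -> summC (fun x => Cadd (f x) (g x)).
Proof. by move=> [a b] [c d]; split; apply: summ_add. Qed.

Lemma summC_scal z f : summC f -> summC (fun x => Cmul z (f x)).
Proof.
move=> [a b]; split; apply: sums_bounded_le (sums_bounded_add
   (sums_bounded_scal (Rabs_pos (Re z)) (sums_bounded_add a b))
   (sums_bounded_scal (Rabs_pos (Im z)) (sums_bounded_add a b))) => x /=.
  have := Rabs_triang (Re z * Re (f x)) (- (Im z * Im (f x))).
  rewrite Rabs_Ropp !Rabs_mult /Rminus.
  have := Rabs_pos (Re z); have := Rabs_pos (Im z).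
  by have := Rabs_pos (Re (f x)); have := Rabs_pos (Im (f x)); nra.
have := Rabs_triang (Re z * Im (f x)) (Im z * Re (f x)).
rewrite !Rabs_mult.
have := Rabs_pos (Re z); have := Rabs_pos (Im z).
by have := Rabs_pos (Re (f x)); have := Rabs_pos (Im (f x)); nra.
Qed.

Lemma sumC_add f g : summC f -> summC g ->
  sumC (fun x => Cadd (f x) (g x)) = Cadd (sumC f) (sumC g).
Proof. by move=> [a b] [c d]; apply: Cx_eq => /=; rewrite sumR_add. Qed.

Lemma sumC_scal z f : summC f -> sumC (fun x => Cmul z (f x)) = Cmul z (sumC f).
Proof.
move=> [a b]; apply: Cx_eq => /=.
  by rewrite sumR_sub ?sumR_scal //; apply: summ_scal.
by rewrite sumR_add ?sumR_scal //; apply: summ_scal.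
Qed.

Lemma sumC_matched sg tu f g : matched C0 sg tu f g -> sumC f = sumC g.
Proof.
by move=> h; apply: Cx_eq => /=; apply: sumR_matched;
  [apply: (matched_comp (h := Re)) h | apply: (matched_comp (h := Im)) h].
Qed.

(** Absolute convergence of the series [inner v w], which is all that linearity needs. It can hold
    when [w] is not square summable: when [v] has finite support, or when [v] carries the cutoff. *)
Definition pairable v w := summC (fun x => Cmul (Cconj (v x)) (w x)).

Lemma pairable_L2 v w : inL2 v -> inL2 w -> pairable v w.
Proof.
move=> hv hw; have b := sums_bounded_scal (a := / 2) ltac:(lra) (sums_bounded_add hv hw).
split; apply: sums_bounded_le b => x.
  by have := Re_conj_mul_bound (v x) (w x); lra.
by have := Im_conj_mul_bound (v x) (w x); lra.
Qed.

Lemma pairable_inD v w : inD v -> pairable v w.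
Proof.
by move=> [l hl]; split; apply: (@summ_finsupp _ _ l) => x /hl -> /=; ring.
Qed.

Lemma inL2_add v w : inL2 v -> inL2 w -> inL2 (vadd v w).
Proof.
move=> hv hw; apply: sums_bounded_le (sums_bounded_add
  (sums_bounded_scal (a := 2) _ hv) (sums_bounded_scal (a := 2) _ hw)); try lra.
by move=> x; apply: Cnorm2_add.
Qed.

Lemma inL2_scal z v : inL2 v -> inL2 (vscal z v).
Proof.
move=> hv; apply: sums_bounded_le (sums_bounded_scal (Cnorm2_ge0 z) hv) => x.
by rewrite /vscal Cnorm2_mul; lra.
Qed.

Lemma inL2_sub v w : inL2 v -> inL2 w -> inL2 (vsub v w).
Proof. by move=> hv hw; apply: inL2_add => //; apply: inL2_scal. Qed.

Lemma inL2_diag M c v : (forall x, c x * c x <= M) -> inL2 v -> inL2 (mul_diag c v).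
Proof.
move=> hc hv; have M0 : forall x : X, 0 <= M by move=> x; have := hc x; nra.
(* Only a point of [X] shows [0 <= M], so the empty index type is treated apart. *)
case: (excluded_middle_informative (inhabited X)) => [[x0]|nX].
  apply: sums_bounded_le (sums_bounded_scal (M0 x0) hv) => x.
  rewrite /mul_diag Cnorm2_mul Cnorm2_CofR.
  exact: Rmult_le_compat_r (Cnorm2_ge0 _) (hc x).
by exists 0; case=> [_|x l _] /=; [lra | case: nX].
Qed.

Lemma inL2_inD v : inD v -> inL2 v.
Proof.
move=> [l hl]; apply: (@sums_bounded_finsupp _ _ l) => [x|x /hl ->]; last exact: Cnorm2_C0.
exact: Cnorm2_ge0.
Qed.

Lemma inD_mul_diag c v : inD v -> inD (mul_diag c v).
Proof. by move=> [l hl]; exists l => x /hl; rewrite /mul_diag => ->; cx. Qed.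

Lemma inD_scal z v : inD v -> inD (vscal z v).
Proof. by move=> [l hl]; exists l => x /hl; rewrite /vscal => ->; cx. Qed.

Lemma inD_add v w : inD v -> inD w -> inD (vadd v w).
Proof.
move=> [l hl] [l' hl']; exists (l ++ l') => x nx; rewrite /vadd hl ?hl'; first cx.
all: by move=> hx; apply: nx; apply: List.in_or_app; auto.
Qed.

Lemma inD_zero : inD (@vzero X).
Proof. by exists [::]. Qed.

Lemma inner_zero_r v : inner v (@vzero X) = C0.
Proof.
rewrite /inner; have -> : (fun x => Cmul (Cconj (v x)) (vzero x)) = (fun=> C0) by vx.
by rewrite /sumC /= sumR_zero.
Qed.

Lemma inner_add_r v w w' : pairable v w -> pairable v w' ->
  inner v (vadd w w') = Cadd (inner v w) (inner v w').
Proof.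
move=> h h'; rewrite /inner -sumC_add //; congr sumC; vx.
Qed.

Lemma inner_scal_r z v w : pairable v w -> inner v (vscal z w) = Cmul z (inner v w).
Proof. by move=> h; rewrite /inner -sumC_scal //; congr sumC; vx. Qed.

Lemma inner_add_l v v' w : pairable v w -> pairable v' w ->
  inner (vadd v v') w = Cadd (inner v w) (inner v' w).
Proof. move=> h h'; rewrite /inner -sumC_add //; congr sumC; vx. Qed.

Lemma inner_scal_l z v w : pairable v w -> inner (vscal z v) w = Cmul (Cconj z) (inner v w).
Proof. by move=> h; rewrite /inner -sumC_scal //; congr sumC; vx. Qed.

Lemma inner_diag c v w : inner v (mul_diag c w) = inner (mul_diag c v) w.
Proof. by rewrite /inner; congr sumC; vx. Qed.

Lemma Re_inner_sym v w : Re (inner v w) = Re (inner w v).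
Proof. by rewrite /=; congr sumR; apply: functional_extensionality => x /=; ring. Qed.

Lemma norm_sqr v : inL2 v -> norm v ^ 2 = psum (fun x => Cnorm2 (v x)).
Proof. by move=> hv; rewrite /norm /= Rmult_1_r sqrt_sqrt //; apply: psum_ge0. Qed.

Definition basis_vec (x : X) : Vec X :=
  fun y => if excluded_middle_informative (y = x) then CofR 1 else C0.

Lemma inD_basis_vec x : inD (basis_vec x).
Proof.
exists [:: x] => y ny; rewrite /basis_vec; case: excluded_middle_informative => // e.
by case: ny; left.
Qed.

Lemma inner_basis_vec v x : inner v (basis_vec x) = Cconj (v x).
Proof.
have dx : basis_vec x x = CofR 1 by rewrite /basis_vec; case: excluded_middle_informative.
have dy y : y <> x -> basis_vec x y = C0 by rewrite /basis_vec; case: excluded_middle_informative.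
by apply: Cx_eq; rewrite /inner /sumC /Defs.Re /Defs.Im (@sumR_single _ _ x) ?dx /=;
  [ring | move=> y /dy -> /= | ring | move=> y /dy -> /=]; ring.
Qed.

Definition Ccv (zk : nat -> Cx) (z : Cx) :=
  Un_cv (fun k => Re (zk k)) (Re z) /\ Un_cv (fun k => Im (zk k)) (Im z).

Lemma Un_cv_const r : Un_cv (fun=> r) r.
Proof. by move=> e he; exists 0%N => k _; rewrite R_dist_eq. Qed.

Lemma Ccv_uniq (zk : nat -> Cx) (z w : Cx) : Ccv zk z -> Ccv zk w -> z = w.
Proof.
move=> [a b] [c d].
by apply: Cx_eq; [exact: (UL_sequence _ _ _ a c) | exact: (UL_sequence _ _ _ b d)].
Qed.

Lemma Ccv_add (zk wk : nat -> Cx) (z w : Cx) :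
  Ccv zk z -> Ccv wk w -> Ccv (fun k => Cadd (zk k) (wk k)) (Cadd z w).
Proof. by move=> [a b] [c d]; split; apply: CV_plus. Qed.

Lemma Ccv_scal (zk : nat -> Cx) (z w : Cx) : Ccv zk z -> Ccv (fun k => Cmul w (zk k)) (Cmul w z).
Proof.
by move=> [a b]; split; [apply: CV_minus | apply: CV_plus]; (apply: CV_mult; last by []);
  exact: Un_cv_const.
Qed.

Lemma Ccv_const z : Ccv (fun=> z) z.
Proof. by split; exact: Un_cv_const. Qed.

Lemma Cnorm2_le_norm v x : inL2 v -> Rabs (Re (v x)) <= norm v /\ Rabs (Im (v x)) <= norm v.
Proof.
move=> hv; have := term_le_psum x hv; rewrite -norm_sqr // /Cnorm2 => h.
have n0 : 0 <= norm v by apply: sqrt_pos.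
by split; apply: Rsqr_incr_0 (Rabs_pos _) n0; rewrite -Rsqr_abs /Rsqr; nra.
Qed.

(** Each coordinate is bounded by the norm. This is what identifies the limits in a closure
    graph. *)
Lemma conv_pointwise uk u x : (forall k, inL2 (uk k)) -> inL2 u -> conv uk u ->
  Ccv (fun k => uk k x) (u x).
Proof.
move=> hk hu hc.
have P k := Cnorm2_le_norm x (inL2_sub (hk k) hu).
split=> e he; have [K hK] := hc e he; exists K => k /hK; rewrite /R_dist Rminus_0_r.
  rewrite (Rabs_pos_eq (norm _)); last exact: sqrt_pos.
  have [h _] := P k; move: h; rewrite /vsub /vadd /vscal /=.
  have -> : Re (uk k x) + (-1 * Re (u x) - 0 * Im (u x)) = Re (uk k x) - Re (u x) by ring.
  lra.
rewrite (Rabs_pos_eq (norm _)); last exact: sqrt_pos.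
have [_ h] := P k; move: h; rewrite /vsub /vadd /vscal /=.
have -> : Im (uk k x) + (-1 * Im (u x) + 0 * Re (u x)) = Im (uk k x) - Im (u x) by ring.
lra.
Qed.

(** Testing against basis vectors reads off the coordinates of [w], so the choice by [epsilon] in
    [adjoint] is forced. *)
Lemma adjoint_graph_uniq (T : Op X) v w w' : (forall u, inD u -> dom T u) ->
  adjoint_graph T v w -> adjoint_graph T v w' -> w = w'.
Proof.
move=> hT [_ [_ h]] [_ [_ h']]; apply: functional_extensionality => x.
have dx := hT _ (inD_basis_vec x).
have := h _ dx; rewrite (h' _ dx) !inner_basis_vec => -[e1 e2]; apply: Cx_eq; lra.
Qed.

Lemma adjoint_app (T : Op X) v w : (forall u, inD u -> dom T u) ->
  adjoint_graph T v w -> dom (adjoint T) v /\ app (adjoint T) v = w.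
Proof.
move=> hT h; have ex : exists w, adjoint_graph T v w by exists w.
by split=> //; apply: adjoint_graph_uniq h => //; exact: (epsilon_spec _ _ ex).
Qed.

End ComplexSums.

(** * Weighted shifts *)

Section Shifts.
Variable X : Type.
Implicit Types (u v w : Vec X).

(* The weighted shift [u |-> (x |-> cf x * u (sg x))], together with its formal adjoint,
   which is given by [df] and [tu]. *)
Record shift := Shift { cf : X -> R; sg : X -> X; df : X -> R; tu : X -> X }.

Definition act (S : shift) u : Vec X := fun x => Cmul (CofR (cf S x)) (u (sg S x)).
Definition sadj (S : shift) := Shift (df S) (tu S) (cf S) (sg S).
Definition scomp (S S' : shift) := Shift
  (fun x => cf S x * cf S' (sg S x)) (fun x => sg S' (sg S x))
  (fun y => df S' y * df S (tu S' y)) (fun y => tu S (tu S' y)).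
Definition sdiag (c : X -> R) := Shift c id c id.

(** [sg] and [tu] need to be mutually inverse only where the weights do not vanish: lowering an
    occupation number by [predn] is not injective at 0, but there the weight [sqrt 0] vanishes. *)
Definition lawful (S : shift) := matched 0 (sg S) (tu S) (cf S) (df S).

Lemma act_scomp S S' u : act (scomp S S') u = act S (act S' u).
Proof. vx. Qed.

Lemma act_sdiag c u : act (sdiag c) u = mul_diag c u.
Proof. by []. Qed.

Lemma lawful_sadj S : lawful S -> lawful (sadj S).
Proof. exact: matched_sym. Qed.

Lemma lawful_scomp S S' : lawful S -> lawful S' -> lawful (scomp S S').
Proof.
move=> [h1 h2] [h1' h2']; split=> x /= hx.
  have [/h1 [e1 e2] /h1' [e3 e4]] : cf S x <> 0 /\ cf S' (sg S x) <> 0.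
    by split=> e; apply: hx; rewrite e; ring.
  by rewrite e4 e3 e1 e2; split; first ring.
have [/h2' [e1 e2] /h2 [e3 e4]] : df S' x <> 0 /\ df S (tu S' x) <> 0.
  by split=> e; apply: hx; rewrite e; ring.
by rewrite e4 e3 e1 e2; split; first ring.
Qed.

Lemma inner_act S u v : lawful S -> inner v (act S u) = inner (act (sadj S) v) u.
Proof.
move=> [h1 h2]; rewrite /inner; apply: (@sumC_matched _ (sg S) (tu S)).
split=> x hx.
  have /h1 [e1 e2] : cf S x <> 0 by move=> e; apply: hx; rewrite /act e; cx.
  by split=> //; rewrite /act /= e1 e2; cx.
have /h2 [e1 e2] : df S x <> 0 by move=> e; apply: hx; rewrite /act /= e; cx.
by split=> //; rewrite /act /= e1 e2; cx.
Qed.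

Lemma inD_act S u : lawful S -> inD u -> inD (act S u).
Proof.
move=> [h1 _] [l hl]; exists (List.map (tu S) l) => x nx.
case: (excluded_middle_informative (cf S x = 0)) => [|/h1 [_ e]].
  by rewrite /act => ->; cx.
rewrite /act hl; first cx.
by move=> hs; apply: nx; rewrite -e; apply: List.in_map.
Qed.

(** Keeping the terms as data lets the adjoint be formed term by term, before anything is known
    about domains. *)
Definition fop := seq (Cx * shift).
Definition fapp (A : fop) u : Vec X :=
  foldr (fun t acc => vadd (vscal t.1 (act t.2 u)) acc) (@vzero X) A.
Definition fadj (A : fop) : fop := [seq (Cconj t.1, sadj t.2) | t <- A].

Lemma fapp_sub A u v : vsub (fapp A u) (fapp A v) = fapp A (vsub u v).
Proof. by elim: A => [|t A IH] /=; [vx | rewrite -IH; vx]. Qed.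

Definition all_lawful (A : fop) := List.Forall (fun t => lawful t.2) A.

Lemma all_lawful_fadj A : all_lawful A -> all_lawful (fadj A).
Proof. by elim=> [|t l h _ IH] /=; constructor => //; exact: lawful_sadj. Qed.

Lemma inD_fapp A u : all_lawful A -> inD u -> inD (fapp A u).
Proof.
move=> hA hu; elim: hA => [|t l h _ IH] /=; first exact: inD_zero.
by apply: inD_add => //; apply: inD_scal; exact: inD_act.
Qed.

(** With [v] in [D] every series is finite, so [u] is arbitrary. This gives the adjoint of a closed
    entry on [D]. *)
Lemma inner_fapp A v u : all_lawful A -> inD v -> inner v (fapp A u) = inner (fapp (fadj A) v) u.
Proof.
move=> hA hv; elim: hA => [|t l h hl IH] /=.
  rewrite inner_zero_r; apply/esym; rewrite /inner.
  have := inner_zero_r u; rewrite /inner => <-; congr sumC; vx.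
have ha := inD_act (lawful_sadj h) hv.
rewrite inner_add_r; try exact: pairable_inD.
rewrite inner_add_l; last 2 first.
- by apply: pairable_inD; apply: inD_scal.
- by apply: pairable_inD; apply: inD_fapp => //; exact: all_lawful_fadj.
rewrite inner_scal_r ?inner_scal_l; try exact: pairable_inD.
rewrite inner_act // IH; cx.
Qed.

(** * Energy grading and polynomial bounds *)

Variable N : X -> R.
Hypothesis N0 : forall x, 0 <= N x.

(** The output at [x] reads the input at [sg S x], so the operator lowers the energy by [d]:
    annihilation has positive [d], creation negative. [k] is the degree of the squared weight in
    [N]. *)
Definition graded (S : shift) (d : R) (k : nat) :=
  [/\ lawful S, forall x, cf S x <> 0 -> N (sg S x) = N x + d
    & exists K, 0 <= K /\ forall x, cf S x * cf S x <= K * (1 + N x) ^ k].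

Lemma graded_sadj S d k : graded S d k -> graded (sadj S) (- d) k.
Proof.
move=> [[h1 h2] hN [K [K0 hK]]]; split; first exact: lawful_sadj.
  move=> y /= dy; have [e1 e2] := h2 _ dy.
  by have := hN (tu S y); rewrite e1 e2 => /(_ dy); lra.
(* The known bound lives at [tu S y], and [1 + N (tu S y) <= (1 + |d|) (1 + N y)]. *)
exists (K * (1 + Rabs d) ^ k); split.
  by apply: Rmult_le_pos => //; apply: pow_le; have := Rabs_pos d; lra.
move=> y /=; case: (excluded_middle_informative (df S y = 0)) => [->|dy].
  rewrite Rmult_0_l; apply: Rmult_le_pos; last by apply: pow_le; have := N0 y; lra.
  by apply: Rmult_le_pos => //; apply: pow_le; have := Rabs_pos d; lra.
have [e1 e2] := h2 _ dy; rewrite -e1.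
apply: Rle_trans (hK _) _; rewrite Rmult_assoc -Rpow_mult_distr.
apply: Rmult_le_compat_l => //; apply: pow_incr; split; first by have := N0 (tu S y); lra.
have := hN (tu S y); rewrite e1 e2 => /(_ dy).
have := Rle_abs (- d); rewrite Rabs_Ropp; have := N0 y; have := Rabs_pos d.
by nra.
Qed.

Lemma graded_scomp S S' d d' k k' : graded S d k -> graded S' d' k' ->
  graded (scomp S S') (d + d') (k + k').
Proof.
move=> [h hN [K [K0 hK]]] [h' hN' [K' [K0' hK']]]; split; first exact: lawful_scomp.
  move=> x /= hx.
  have [a b] : cf S x <> 0 /\ cf S' (sg S x) <> 0.
    by split=> e; apply: hx; rewrite e; ring.
  by rewrite hN' // hN //; ring.
have B0 : 0 <= (1 + Rabs d) ^ k' by apply: pow_le; have := Rabs_pos d; lra.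
have C0' : 0 <= K * (K' * (1 + Rabs d) ^ k') by apply: Rmult_le_pos => //; apply: Rmult_le_pos.
exists (K * (K' * (1 + Rabs d) ^ k')); split=> // x /=.
have P j : 0 <= (1 + N x) ^ j by apply: pow_le; have := N0 x; lra.
case: (excluded_middle_informative (cf S x = 0)) => [->|cx].
  by rewrite !Rmult_0_l; apply: Rmult_le_pos.
have -> : cf S x * cf S' (sg S x) * (cf S x * cf S' (sg S x)) =
  (cf S x * cf S x) * (cf S' (sg S x) * cf S' (sg S x)) by ring.
rewrite pow_add.
have -> : K * (K' * (1 + Rabs d) ^ k') * ((1 + N x) ^ k * (1 + N x) ^ k') =
  (K * (1 + N x) ^ k) * (K' * ((1 + Rabs d) * (1 + N x)) ^ k').
  by rewrite Rpow_mult_distr; ring.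
apply: Rmult_le_compat; try by nra.
  exact: hK.
apply: Rle_trans (hK' _) _; apply: Rmult_le_compat_l => //; apply: pow_incr.
split; first by have := N0 (sg S x); lra.
rewrite hN //; have := Rle_abs d; have := Rabs_pos d; have := N0 x; nra.
Qed.

Lemma graded_le S d k k' : (k <= k')%N -> graded S d k -> graded S d k'.
Proof.
move=> lek [h hN [K [K0 hK]]]; split=> //; exists K; split=> // x.
apply: Rle_trans (hK x) _; apply: Rmult_le_compat_l => //.
by apply: Rle_pow; [have := N0 x; lra | exact/leP].
Qed.

(** Membership in the domain of [(1 + N)^(p/2)]. *)
Definition weighted (p : nat) u := sums_bounded (fun x => (1 + N x) ^ p * Cnorm2 (u x)).

(** Reindexing moves the squared weights onto the coordinates of [u], where they become the weights
    [df] of the adjoint shift; hence the constant is the one of [graded_sadj]. *)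
Lemma act_bound S d p : graded S d p -> exists K, 0 <= K /\ forall u, weighted p u ->
  inL2 (act S u) /\
  psum (fun x => Cnorm2 (act S u x)) <= K * psum (fun x => (1 + N x) ^ p * Cnorm2 (u x)).
Proof.
move=> gS; have [_ _ [K [K0 hK]]] := graded_sadj gS; exists K; split=> // u wu.
have [[h1 h2] _ _] := gS.
have m : matched 0 (sg S) (tu S) (fun x => Cnorm2 (act S u x))
    (fun y => df S y * df S y * Cnorm2 (u y)).
  split=> x hx.
    have /h1 [e1 e2] : cf S x <> 0.
      by move=> e; apply: hx; rewrite /act Cnorm2_mul Cnorm2_CofR e; ring.
    by rewrite e1 e2 /act Cnorm2_mul Cnorm2_CofR.
  have /h2 [e1 e2] : df S x <> 0 by move=> e; apply: hx; rewrite e; ring.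
  by rewrite /act Cnorm2_mul Cnorm2_CofR e1 e2.
have le y : df S y * df S y * Cnorm2 (u y) <= K * ((1 + N y) ^ p * Cnorm2 (u y)).
  by rewrite -Rmult_assoc; apply: Rmult_le_compat_r (hK y); exact: Cnorm2_ge0.
have b := sums_bounded_scal K0 wu.
split; first exact: sums_bounded_matched m (sums_bounded_le le b).
by rewrite (psum_matched m) -psum_scal //; exact: psum_le.
Qed.

Definition all_graded (p : nat) (A : fop) := List.Forall (fun t => exists d, graded t.2 d p) A.

Lemma all_graded_lawful p A : all_graded p A -> all_lawful A.
Proof. by apply: List.Forall_impl => t [d []]. Qed.

Lemma all_graded_fadj p A : all_graded p A -> all_graded p (fadj A).
Proof.
elim=> [|t l [d h] _ IH] /=; constructor => //; exists (- d); exact: graded_sadj.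
Qed.

Lemma fapp_bound p A : all_graded p A -> exists K, 0 <= K /\ forall u, weighted p u ->
  inL2 (fapp A u) /\
  psum (fun x => Cnorm2 (fapp A u x)) <= K * psum (fun x => (1 + N x) ^ p * Cnorm2 (u x)).
Proof.
elim=> [|t l [d h] _ [K [K0 hK]]] /=.
  exists 0; split=> [|u wu]; first lra.
  split; first by apply: inL2_inD; exact: inD_zero.
  have -> : (fun x : X => Cnorm2 (vzero x)) = (fun=> 0).
    by apply: functional_extensionality => x; rewrite /vzero Cnorm2_C0.
  by rewrite psum_zero; lra.
have [K' [K0' hK']] := act_bound h.
have z0 := Cnorm2_ge0 t.1.
exists (2 * (Cnorm2 t.1 * K') + 2 * K); split; first by nra.
move=> u wu; have [a1 a2] := hK u wu; have [b1 b2] := hK' u wu.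
split; first by apply: inL2_add => //; exact: inL2_scal.
have b3 := sums_bounded_scal z0 b1.
have two : 0 <= 2 by lra.
apply: Rle_trans (psum_le (fun x => Cnorm2_add _ _) _) _.
  apply: sums_bounded_add; apply: sums_bounded_scal => //; exact: inL2_scal.
rewrite psum_add; try by move=> x; have := Cnorm2_ge0 (vscal t.1 (act t.2 u) x);
  have := Cnorm2_ge0 (fapp l u x); lra.
- rewrite !psum_scal //; last exact: inL2_scal.
  have -> : (fun x => Cnorm2 (vscal t.1 (act t.2 u) x)) =
            (fun x => Cnorm2 t.1 * Cnorm2 (act t.2 u x)).
    by apply: functional_extensionality => x; rewrite -Cnorm2_mul.
  rewrite psum_scal //; nra.
- by apply: sums_bounded_scal => //; exact: inL2_scal.
- exact: sums_bounded_scal.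
Qed.

Lemma weighted_inD p u : inD u -> weighted p u.
Proof.
move=> [l hl]; apply: (@sums_bounded_finsupp _ _ l) => [x|x /hl ->].
  by apply: Rmult_le_pos; [apply: pow_le; have := N0 x; lra | exact: Cnorm2_ge0].
by rewrite Cnorm2_C0; ring.
Qed.

Lemma weighted_inL2 p u : weighted p u -> inL2 u.
Proof.
apply: sums_bounded_le => x; rewrite -[X in X <= _]Rmult_1_l.
apply: Rmult_le_compat_r; first exact: Cnorm2_ge0.
by apply: pow_R1_Rle; have := N0 x; lra.
Qed.

Definition trunc (l : seq X) u : Vec X :=
  fun x => if excluded_middle_informative (List.In x l) then u x else C0.

Lemma inD_trunc l u : inD (trunc l u).
Proof. by exists l => x nx; rewrite /trunc; case: excluded_middle_informative. Qed.

Lemma trunc_approx (h : X -> R) u : (forall x, 0 <= h x) ->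
  sums_bounded (fun x => h x * Cnorm2 (u x)) -> forall e, 0 < e ->
  exists l, psum (fun x => h x * Cnorm2 (vsub (trunc l u) u x)) <= e.
Proof.
move=> h0 b e e0; pose f x := h x * Cnorm2 (u x).
have f0 x : 0 <= f x by apply: Rmult_le_pos => //; exact: Cnorm2_ge0.
have [l [nd hl]] : exists l, List.NoDup l /\ psum f - e < lsum f l.
  case: (classic (exists l, List.NoDup l /\ psum f - e < lsum f l)) => // nex.
  suff : psum f <= psum f - e by lra.
  apply: psum_le_bound => l nd; apply: Rnot_lt_le => lt; apply: nex; by exists l.
exists l; set q := fun x => _.
(* [p] is the part of [f] on the list and [q] the weighted squared error of the truncation. They add
   up to [f], so the error is what the chosen partial sum misses. *)
pose p x := if excluded_middle_informative (List.In x l) then f x else 0.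
have q0 x : 0 <= q x by apply: Rmult_le_pos => //; exact: Cnorm2_ge0.
have p0 x : 0 <= p x by rewrite /p; case: excluded_middle_informative => ? /=; [exact: f0 | lra].
have epq : f = (fun x => p x + q x).
  apply: functional_extensionality => x; rewrite /p /q /f /vsub /vadd /vscal /trunc.
  by case: excluded_middle_informative => ? /=; rewrite /Cnorm2 /=; ring.
have bp : sums_bounded p by apply: sums_bounded_le b => x; rewrite -/(f x) epq; have := q0 x; lra.
have bq : sums_bounded q by apply: sums_bounded_le b => x; rewrite -/(f x) epq; have := p0 x; lra.
have : psum f = psum p + psum q by rewrite epq psum_add.
suff : lsum f l <= psum p by lra.
have -> : lsum f l = lsum p l; last exact: lsum_le_psum.
by apply: lsum_eq_in => x; rewrite /p; case: excluded_middle_informative.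
Qed.

Lemma conv_of_sqr (uk : nat -> Vec X) u M : 0 <= M -> (forall k, inL2 (vsub (uk k) u)) ->
  (forall k, psum (fun x => Cnorm2 (vsub (uk k) u x)) <= M * RinvN k) -> conv uk u.
Proof.
move=> M0 hL h e e0.
(* Dividing by [M + 1] rather than [M] covers [M = 0]. *)
have e1 : 0 < e * e / (M + 1) by apply: Rdiv_lt_0_compat; nra.
have [K hK] := RinvN_cv e1; exists K => k /hK.
rewrite /R_dist !Rminus_0_r (Rabs_pos_eq (norm _)); last exact: sqrt_pos.
rewrite Rabs_pos_eq; last by left; exact: cond_pos.
move=> lt; rewrite /norm -(sqrt_square e); last lra.
apply: sqrt_lt_1_alt; have := h k; have := cond_pos (RinvN k).
set P := psum _ => lt' hP; move: lt lt' hP; set r := pos _ => lt r0 hP.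
have : (M + 1) * r < e * e.
  have := Rmult_lt_compat_l (M + 1) _ _ ltac:(lra) lt.
  have -> : (M + 1) * (e * e / (M + 1)) = e * e by field; lra.
  by [].
have P0 : 0 <= P by apply: psum_ge0; exact: hL.
by split; nra.
Qed.

End Shifts.

(** * Closures and the model operators *)

Section Closures.
Variable X : Type.
Variable N : X -> R.
Hypothesis N0 : forall x, 0 <= N x.
Implicit Types (u v : Vec X).

Lemma Ccv_fapp A (uk : nat -> Vec X) u : (forall x, Ccv (fun k => uk k x) (u x)) ->
  forall x, Ccv (fun k => fapp A (uk k) x) (fapp A u x).
Proof.
move=> h; elim: A => [|t A IH] x /=; first exact: Ccv_const.
by apply: Ccv_add => //; do 2!apply: Ccv_scal.
Qed.

(** Interface to an operator known only through [epsilon]. Its exact domain is never computed: it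
    lies between a weighted space and the vectors on which the formula is square summable. The third
    clause serves (0), the fourth (a), the second (b). *)
Definition represents (p : nat) (A : fop X) (F : Op X) :=
  [/\ all_graded N p A,
      forall u, dom F u -> [/\ inL2 u, inL2 (fapp A u) & app F u = fapp A u],
      forall u, weighted N p u -> dom F u
    & forall v, inD v -> dom (adjoint F) v /\ app (adjoint F) v = fapp (fadj A) v].

Lemma closure_represents p A (T : Op X) : all_graded N p A ->
  (forall u, dom T u <-> inD u) -> (forall u, inD u -> app T u = fapp A u) ->
  represents p A (Defs.closure T).
Proof.
move=> gA hD hT; have lA := all_graded_lawful gA.
have appD u : dom T u -> inD (app T u) by move=> /hD hu; rewrite hT //; exact: inD_fapp.
(* A coordinate of [fapp A u] involves finitely many coordinates of [u], so it passes to
   coordinatewise limits; uniqueness of limits then fixes [v]. *)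
have form u v : closure_graph T u v -> v = fapp A u.
  move=> [hu [hv [uk [dk [ck ck']]]]]; apply: functional_extensionality => x.
  have L2k k : inL2 (uk k) by apply: inL2_inD; apply/hD.
  have c1 y := conv_pointwise y L2k hu ck.
  have c2 := conv_pointwise x (fun k => inL2_inD (appD _ (dk k))) hv ck'.
  apply: Ccv_uniq c2 _.
  have -> : (fun k => app T (uk k) x) = (fun k => fapp A (uk k) x).
    by apply: functional_extensionality => k; rewrite hT //; apply/hD.
  exact: Ccv_fapp.
have appC u : dom (Defs.closure T) u -> [/\ inL2 u, inL2 (fapp A u) & app (Defs.closure T) u = fapp A u].
  move=> /= ex; have h := epsilon_spec (inhabits (@vzero X)) _ ex.
  by have e := form _ _ h; rewrite -e; case: h => ? [].
(* Truncations that approximate [u] with weight [(1 + N)^p] converge in norm, and by [fapp_bound]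
   their images converge as well. *)
have domC u : weighted N p u -> dom (Defs.closure T) u.
  move=> wu; have [K [K0 hK]] := fapp_bound N0 gA.
  exists (fapp A u); split; first exact: weighted_inL2 wu.
  split; first by case: (hK _ wu).
  have w0 x : 0 <= (1 + N x) ^ p by apply: pow_le; have := N0 x; lra.
  pose P k l := psum (fun x => (1 + N x) ^ p * Cnorm2 (vsub (trunc l u) u x)) <= RinvN k.
  have ex k : exists l, P k l.
    by apply: trunc_approx => //; exact: cond_pos.
  pose lk k := proj1_sig (constructive_indefinite_description _ (ex k)).
  have hl k : P k (lk k) := proj2_sig (constructive_indefinite_description _ (ex k)).
  have wk k : weighted N p (vsub (trunc (lk k) u) u).
    apply: sums_bounded_le wu => x; apply: Rmult_le_compat_l => //.
    rewrite /vsub /vadd /vscal /trunc; case: excluded_middle_informative => ? /=;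
      rewrite /Cnorm2 /=; nra.
  exists (fun k => trunc (lk k) u); split; first by move=> k; apply/hD; exact: inD_trunc.
  split.
    apply: (@conv_of_sqr _ _ _ 1) => [|k|k]; first lra.
      exact: weighted_inL2 (wk k).
    rewrite Rmult_1_l; apply: Rle_trans (hl k); apply: psum_le (wk k) => x.
    rewrite -[X in X <= _]Rmult_1_l; apply: Rmult_le_compat_r; first exact: Cnorm2_ge0.
    by apply: pow_R1_Rle; have := N0 x; lra.
  have -> : (fun k => app T (trunc (lk k) u)) = (fun k => fapp A (trunc (lk k) u)).
    by apply: functional_extensionality => k; rewrite hT //; exact: inD_trunc.
  apply: (@conv_of_sqr _ _ _ K) => // k; rewrite fapp_sub; have [h1 h2] := hK _ (wk k) => //.
  by apply: Rle_trans h2 _; apply: Rmult_le_compat_l => //; exact: hl.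
split=> // v hv; apply: adjoint_app.
  by move=> u hu; apply: domC; exact: weighted_inD.
split; first exact: inL2_inD.
split; first by apply: inL2_inD; apply: inD_fapp => //; exact: all_lawful_fadj.
by move=> u /appC [_ _ ->]; exact: inner_fapp.
Qed.

End Closures.

(** * Products of shifts *)

Section ProductShifts.
Variables (X : Type) (I : Type) (Sf : I -> shift X).
Implicit Types (u : Vec X) (l : seq I).

Definition prod_shift l := foldr (fun t acc => scomp (Sf t) acc) (sdiag (fun=> 1)) l.

Lemma prod_ops_comm (A : I -> Vec X -> Vec X) (B : Vec X -> Vec X) l u :
  (forall t u, A t (B u) = B (A t u)) ->
  foldr (fun A acc => fun u => A (acc u)) id (map A l) (B u) =
  B (foldr (fun A acc => fun u => A (acc u)) id (map A l) u).
Proof. by move=> h; elim: l => //= t l ->. Qed.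

Lemma act_prod_shift l u :
  act (prod_shift l) u = foldr (fun A acc => fun u => A (acc u)) id (map (fun t => act (Sf t)) l) u.
Proof. by elim: l => [|t l IH] /=; [vx | rewrite act_scomp IH]. Qed.

(** Taking adjoints reverses the order of the factors; commutation restores it. *)
Lemma act_adj_prod_shift l u :
  (forall s t u, act (sadj (Sf s)) (act (sadj (Sf t)) u) = act (sadj (Sf t)) (act (sadj (Sf s)) u)) ->
  act (sadj (prod_shift l)) u =
  foldr (fun A acc => fun u => A (acc u)) id (map (fun t => act (sadj (Sf t))) l) u.
Proof.
move=> h; elim: l u => [|t l IH] u /=; first vx.
have -> : act (sadj (scomp (Sf t) (prod_shift l))) u =
  act (sadj (prod_shift l)) (act (sadj (Sf t)) u) by vx.
by rewrite IH prod_ops_comm // => s w; apply: h.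
Qed.

Lemma graded_prod_shift (N : X -> R) (N0 : forall x, 0 <= N x) (d : I -> R) l :
  (forall t, graded N (Sf t) (d t) 1) ->
  graded N (prod_shift l) (foldr (fun t acc => d t + acc) 0 l) (size l).
Proof.
move=> h; elim: l => [|t l IH] /=; last exact: (graded_scomp N0 (h t) IH).
split=> //; first by move=> x _ /=; ring.
by exists 1; split=> [|x /=]; lra.
Qed.

End ProductShifts.

(** * Finite real sums and updates of one mode *)

Lemma fsumR_update (T : finType) (f f' : T -> R) (i : T) :
  (forall j, j != i -> f' j = f j) -> fsumR f' = fsumR f + (f' i - f i).
Proof.
move=> h; rewrite /fsumR.
have : i \in enum T by rewrite mem_enum.
have : uniq (enum T) by apply: enum_uniq.
elim: (enum T) => //= t l IH /andP[tl ul]; rewrite inE.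
case: (eqVneq i t) => [eit _|nit /= il]; last first.
  by rewrite IH // h 1?eq_sym //; ring.
rewrite -eit in tl *.
suff -> : foldr (fun t acc => f' t + acc) 0 l = foldr (fun t acc => f t + acc) 0 l by ring.
elim: l tl {IH ul} => //= s l IH; rewrite inE negb_or => /andP[si sl].
by rewrite IH // h // eq_sym.
Qed.

Lemma fsumR_ge0 (T : finType) (f : T -> R) : (forall t, 0 <= f t) -> 0 <= fsumR f.
Proof.
by move=> h; rewrite /fsumR; elim: (enum T) => /= [|t l IH]; [lra | have := h t; lra].
Qed.

Lemma le_fsumR (T : finType) (f : T -> R) i : (forall t, 0 <= f t) -> f i <= fsumR f.
Proof.
move=> h; rewrite /fsumR.
have : i \in enum T by rewrite mem_enum.
elim: (enum T) => //= t l IH; rewrite inE => /orP[/eqP ->|/IH].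
  suff : 0 <= foldr (fun t acc => f t + acc) 0 l by lra.
  by elim: l {IH} => /= [|s l IH]; [lra | have := h s; lra].
by have := h t; lra.
Qed.

Lemma updE k (s : 'I_k -> nat) i f : upd s i f i = f (s i).
Proof. by rewrite /upd eqxx. Qed.

Lemma upd_comm k (s : 'I_k -> nat) i j f : upd (upd s i f) j f = upd (upd s j f) i f.
Proof.
apply: functional_extensionality => a; rewrite /upd.
by case: (a == j); case: (a == i).
Qed.

Lemma upd_cancel k (s : 'I_k -> nat) i f f' : f' (f (s i)) = s i -> upd (upd s i f) i f' = s.
Proof.
move=> e; apply: functional_extensionality => a; rewrite /upd.
by case: (eqVneq a i) => [->|//].
Qed.

Lemma sqrt_INR_neq0 k : sqrt (INR k) <> 0 -> (0 < k)%N.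
Proof. by case: k => //; rewrite /= sqrt_0. Qed.

(** * Modes, interaction and channels as weighted shifts *)

Section Modes.
Variables (n m : nat) (ws : 'I_n -> R) (wp : 'I_m -> R).
Hypothesis hws : forall i, 0 < ws i.
Hypothesis hwp : forall j, 0 < wp j.
Local Notation V := (Vec (Idx n m)).
Local Notation Nv := (Nval ws wp).

(** Acting with it and with its [sadj] unfolds to [ann_a] and [cre_a], so the adjoint pair is built
    into one record. *)
Definition shift_a (k : 'I_n) : shift (Idx n m) := Shift
  (fun x => sqrt (INR (x.1 k).+1)) (fun x => (upd x.1 k S, x.2))
  (fun x => sqrt (INR (x.1 k))) (fun x => (upd x.1 k predn, x.2)).
Definition shift_b (k : 'I_m) : shift (Idx n m) := Shift
  (fun x => sqrt (INR (x.2 k).+1)) (fun x => (x.1, upd x.2 k S))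
  (fun x => sqrt (INR (x.2 k))) (fun x => (x.1, upd x.2 k predn)).

Lemma Nval_ge0 x : 0 <= Nv x.
Proof.
have h1 : 0 <= fsumR (fun i => ws i * INR (x.1 i)).
  by apply: fsumR_ge0 => i; apply: Rmult_le_pos; [left | exact: pos_INR].
have h2 : 0 <= fsumR (fun i => wp i * INR (x.2 i)).
  by apply: fsumR_ge0 => i; apply: Rmult_le_pos; [left | exact: pos_INR].
by rewrite /Nval; lra.
Qed.

Lemma mode_bound w t N : 0 < w -> w * INR t <= N ->
  sqrt (INR t.+1) * sqrt (INR t.+1) <= (1 + / w) * (1 + N) ^ 1.
Proof.
move=> w0 h; rewrite sqrt_sqrt; last exact: pos_INR.
rewrite S_INR pow_1; have := pos_INR t.
have iw : 0 < / w by apply: Rinv_0_lt_compat.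
have : / w * (w * INR t) <= / w * N by apply: Rmult_le_compat_l => //; lra.
rewrite -Rmult_assoc Rinv_l; last lra.
by nra.
Qed.

Lemma graded_shift_a k : graded Nv (shift_a k) (ws k) 1.
Proof.
split.
- split=> [[s p] _|[s p] h]; first by rewrite /= updE upd_cancel.
  have sk := @sqrt_INR_neq0 (s k) h; split; last by rewrite /= upd_cancel //= prednK.
  by change (sqrt (INR (upd s k predn k).+1) = sqrt (INR (s k))); rewrite updE prednK.
- move=> [s p] _; rewrite /Nval /=.
  have -> : fsumR (fun i => ws i * INR (upd s k S i)) = fsumR (fun i => ws i * INR (s i)) + ws k.
    rewrite (@fsumR_update _ (fun i => ws i * INR (s i)) _ k).
      by congr (_ + _); rewrite updE S_INR; ring.
    by move=> j nj; rewrite /upd (negbTE nj).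
  by rewrite !Rplus_assoc; congr (_ + _); exact: Rplus_comm.
exists (1 + / ws k); split; first by have := Rinv_0_lt_compat _ (hws k); lra.
move=> x; apply: mode_bound => //; rewrite /Nval.
have := @le_fsumR _ (fun i => ws i * INR (x.1 i)) k
  (fun i => Rmult_le_pos _ _ (Rlt_le _ _ (hws i)) (pos_INR _)).
have := @fsumR_ge0 _ (fun i => wp i * INR (x.2 i))
  (fun i => Rmult_le_pos _ _ (Rlt_le _ _ (hwp i)) (pos_INR _)).
by lra.
Qed.

Lemma graded_shift_b k : graded Nv (shift_b k) (wp k) 1.
Proof.
split.
- split=> [[s p] _|[s p] h]; first by rewrite /= updE upd_cancel.
  have sk := @sqrt_INR_neq0 (p k) h; split; last by rewrite /= upd_cancel //= prednK.
  by change (sqrt (INR (upd p k predn k).+1) = sqrt (INR (p k))); rewrite updE prednK.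
- move=> [s p] _; rewrite /Nval /=.
  have -> : fsumR (fun i => wp i * INR (upd p k S i)) = fsumR (fun i => wp i * INR (p i)) + wp k.
    rewrite (@fsumR_update _ (fun i => wp i * INR (p i)) _ k).
      by congr (_ + _); rewrite updE S_INR; ring.
    by move=> j nj; rewrite /upd (negbTE nj).
  exact/esym/Rplus_assoc.
exists (1 + / wp k); split; first by have := Rinv_0_lt_compat _ (hwp k); lra.
move=> x; apply: mode_bound => //; rewrite /Nval.
have := @le_fsumR _ (fun i => wp i * INR (x.2 i)) k
  (fun i => Rmult_le_pos _ _ (Rlt_le _ _ (hwp i)) (pos_INR _)).
have := @fsumR_ge0 _ (fun i => ws i * INR (x.1 i))
  (fun i => Rmult_le_pos _ _ (Rlt_le _ _ (hws i)) (pos_INR _)).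
by lra.
Qed.

Definition shift_W : shift (Idx n m) :=
  scomp (prod_shift (fun i => sadj (shift_a i)) (enum 'I_n)) (prod_shift shift_b (enum 'I_m)).

Lemma ann_a_comm i j (u : V) : ann_a i (ann_a j u) = ann_a j (ann_a i u).
Proof.
case: (eqVneq i j) => [-> //|ij].
apply: functional_extensionality => -[s p]; rewrite /ann_a /=.
have -> : upd s i S j = s j by rewrite /upd eq_sym (negbTE ij).
have -> : upd s j S i = s i by rewrite /upd (negbTE ij).
by rewrite upd_comm; cx.
Qed.

Lemma cre_b_comm i j (u : V) : cre_b i (cre_b j u) = cre_b j (cre_b i u).
Proof.
case: (eqVneq i j) => [-> //|ij].
apply: functional_extensionality => -[s p]; rewrite /cre_b /=.
have -> : upd p i predn j = p j by rewrite /upd eq_sym (negbTE ij).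
have -> : upd p j predn i = p i by rewrite /upd (negbTE ij).
by rewrite upd_comm; cx.
Qed.

Lemma Iform_shift (u : V) : Iform u = vsub (act shift_W u) (act (sadj shift_W) u).
Proof.
rewrite /Iform; congr vsub.
  by rewrite /shift_W act_scomp !act_prod_shift.
have -> : act (sadj shift_W) u = act (sadj (prod_shift shift_b (enum 'I_m)))
  (act (sadj (prod_shift (fun i => sadj (shift_a i)) (enum 'I_n))) u) by vx.
rewrite act_adj_prod_shift; last exact: cre_b_comm.
rewrite act_adj_prod_shift; last exact: ann_a_comm.
(* The adjoint of the product puts the [b] factors on the outside, while [Iform] has them inside;
   they act on different modes than the [a] factors and commute with them. *)
rewrite (@prod_ops_comm _ _ _
  (foldr (fun A acc => fun u => A (acc u)) id (map (fun i => act (sadj (sadj (shift_a i)))) (enum 'I_n)))) //.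
move=> j w; rewrite -(@prod_ops_comm _ _ _ (act (sadj (shift_b j)))) // => i w'; vx.
Qed.

Hypothesis hsum : fsumR ws = fsumR wp.

(** The equality of the frequency sums enters here: the product creates one quantum in each [a] mode
    and removes one from each [b] mode. Each of the [n + m] factors contributes one degree. *)
Lemma graded_shift_W : graded Nv shift_W 0 (n + m).
Proof.
have := graded_scomp Nval_ge0
  (graded_prod_shift Nval_ge0 (enum 'I_n) (fun i => graded_sadj Nval_ge0 (graded_shift_a i)))
  (graded_prod_shift Nval_ge0 (enum 'I_m) graded_shift_b).
rewrite !size_enum_ord.
have -> : foldr (fun t acc => - ws t + acc) 0 (enum 'I_n) = - fsumR ws.
  by rewrite /fsumR; elim: (enum 'I_n) => /= [|t l ->]; ring.
have -> : foldr (fun t acc => wp t + acc) 0 (enum 'I_m) = fsumR wp by [].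
by rewrite hsum Rplus_opp_l.
Qed.

Variables (g : R) (alpha : chan n m -> Cx).

Definition chan_shift (c : chan n m) : shift (Idx n m) :=
  match c with
  | inl (l, i) => if nat_of_ord l == 3%N then sadj (shift_a i) else shift_a i
  | inr (l, j) => if nat_of_ord l == 3%N then sadj (shift_b j) else shift_b j
  end.

Lemma chan_op_shift c (u : V) : chan_op c u = act (chan_shift c) u.
Proof. by case: c => -[l i] /=; case: ifP. Qed.

Lemma graded_chan_shift c : exists d, graded Nv (chan_shift c) d 1.
Proof.
case: c => -[l i] /=; case: ifP => _.
- by exists (- ws i); apply: graded_sadj; [exact: Nval_ge0 | exact: graded_shift_a].
- by exists (ws i); exact: graded_shift_a.
- by exists (- wp i); apply: graded_sadj; [exact: Nval_ge0 | exact: graded_shift_b].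
- by exists (wp i); exact: graded_shift_b.
Qed.

Lemma lawful_chan_shift c : lawful (chan_shift c).
Proof. by have [d []] := graded_chan_shift c. Qed.

Definition fop_R c : fop (Idx n m) := [:: (alpha c, chan_shift c)].
Definition fop_N c : fop (Idx n m) :=
  [:: (Cmul (CofR (-1)) (Cconj (alpha c)), sadj (chan_shift c))].
Definition fop_damping (l : seq (chan n m)) : fop (Idx n m) :=
  [seq (CofR (-1 / 2 * Cnorm2 (alpha c)), scomp (sadj (chan_shift c)) (chan_shift c)) | c <- l].
(** The coefficients [g/2] and [-(g/2)] are real because [-i] from [K] meets the [i g/2] in front of
    the interaction. *)
Definition fop_K : fop (Idx n m) :=
  (Copp Ci, sdiag Nv) :: (CofR (g / 2), shift_W) :: (CofR (- (g / 2)), sadj shift_W) ::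
  fop_damping (enum (chan n m)).
Definition fop_F (i j : option (chan n m)) : fop (Idx n m) :=
  match i, j with
  | None, None => fop_K
  | Some c, None => fop_R c
  | None, Some c => fop_N c
  | Some _, Some _ => [::]
  end.

Variable p : nat.
Hypothesis hp : (n + m <= p)%N.
Hypothesis hp2 : (2 <= p)%N.

(** The interaction asks for degree [n + m]; the diagonal [N] and the products in the damping ask
    for 2. *)
Lemma all_graded_fop_F i j : all_graded Nv p (fop_F i j).
Proof.
have h1 c : exists d, graded Nv (chan_shift c) d p.
  by have [d h] := graded_chan_shift c; exists d; apply: graded_le h => //;
    [exact: Nval_ge0 | exact: leq_trans hp2].
have h1' c : exists d, graded Nv (sadj (chan_shift c)) d p.
  by have [d h] := h1 c; exists (- d); apply: graded_sadj => //; exact: Nval_ge0.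
case: i j => [c|] [c'|].
- exact: List.Forall_nil.
- by apply: List.Forall_cons; [exact: h1 | exact: List.Forall_nil].
- by apply: List.Forall_cons; [exact: h1' | exact: List.Forall_nil].
constructor.
  exists 0; split=> //= [x _|]; first ring.
  exists 1; split=> [|x]; first lra.
  have N0 := Nval_ge0 x.
  have := @Rle_pow (1 + Nv x) 2 p ltac:(lra) ltac:(exact/leP); rewrite /= => h.
  by apply: Rle_trans (_ : _ <= _) (Rle_trans _ _ _ h _); nra.
have gW : graded Nv shift_W 0 p := graded_le Nval_ge0 hp graded_shift_W.
constructor; first by exists 0.
constructor; first by exists (- 0); apply: graded_sadj => //; exact: Nval_ge0.
rewrite /fop_damping; elim: (enum _) => [|c l IH] /=; constructor => //=.
have [d h] := graded_chan_shift c; exists (- d + d).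
exact: (graded_le Nval_ge0 hp2 (graded_scomp Nval_ge0 (graded_sadj Nval_ge0 h) h)).
Qed.

Lemma Rop_represents c : represents Nv p (fop_R c) (Defs.closure (Rop alpha c)).
Proof.
apply: closure_represents => //; first exact: Nval_ge0.
  exact: (all_graded_fop_F (Some c) None).
by move=> u _ /=; rewrite chan_op_shift; vx.
Qed.

Lemma Rstar_app c (v : V) : inD v ->
  dom (Rstar alpha c) v /\
  app (Rstar alpha c) v = vscal (Cconj (alpha c)) (act (sadj (chan_shift c)) v).
Proof.
move=> hv; have [_ _ _ h] := Rop_represents c; have [h1 h2] := h _ hv.
by split=> //; rewrite h2 /=; vx.
Qed.

Lemma Rsum_app (u : V) : inD u -> dom (Rsum alpha) u /\
  vscal (CofR (-1 / 2)) (app (Rsum alpha) u) = fapp (fop_damping (enum (chan n m))) u.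
Proof.
move=> hu; rewrite /Rsum; elim: (enum _) => [|c l [IH1 IH2]]; first by split=> //=; vx.
(* The channel operator preserves [D], so its adjoint is applied only where its formula is known. *)
have hR : inD (vscal (alpha c) (chan_op c u)).
  by apply: inD_scal; rewrite chan_op_shift; exact: (inD_act (lawful_chan_shift c) hu).
have [h1 h2] := Rstar_app c hR.
split; first by split; [split|].
change (vscal (CofR (-1 / 2)) (vadd (app (Rstar alpha c) (vscal (alpha c) (chan_op c u)))
  (app (foldr (fun c acc => op_add (op_comp (Rstar alpha c) (Rop alpha c)) acc) (op_zero _) l) u))
  = vadd (vscal (CofR (-1 / 2 * Cnorm2 (alpha c)))
      (act (scomp (sadj (chan_shift c)) (chan_shift c)) u)) (fapp (fop_damping l) u)).
rewrite -IH2 h2 chan_op_shift act_scomp.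
move: (app (foldr _ _ _) u) => Y.
apply: functional_extensionality => x; apply: Cx_eq => /=; rewrite /Cnorm2; field.
Qed.

Lemma Kop_app (u : V) : inD u -> dom (Kop ws wp g alpha) u /\
  app (Kop ws wp g alpha) u = fapp fop_K u.
Proof.
move=> hu; have [h1 h2] := Rsum_app hu.
split; first by split.
have -> : fapp fop_K u = vadd (vscal (Copp Ci) (mul_diag Nv u))
    (vadd (vscal (CofR (g / 2)) (act shift_W u))
      (vadd (vscal (CofR (- (g / 2))) (act (sadj shift_W) u))
        (fapp (fop_damping (enum (chan n m))) u))) by [].
rewrite -h2.
change (vadd (vscal (Copp Ci) (vadd (mul_diag Nv u) (vscal (mkC 0 (g / 2)) (Iform u))))
  (vscal (CofR (-1 / 2)) (app (Rsum alpha) u)) = vadd (vscal (Copp Ci) (mul_diag Nv u))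
    (vadd (vscal (CofR (g / 2)) (act shift_W u))
      (vadd (vscal (CofR (- (g / 2))) (act (sadj shift_W) u))
        (vscal (CofR (-1 / 2)) (app (Rsum alpha) u))))).
rewrite Iform_shift; move: (app _ u) => Y.
by apply: functional_extensionality => x; apply: Cx_eq => /=; field.
Qed.

Lemma Fop_represents i j : represents Nv p (fop_F i j) (Fop ws wp g alpha i j).
Proof.
have gF := all_graded_fop_F i j.
case: i j gF => [c|] [c'|] gF; apply: closure_represents => //; try exact: Nval_ge0.
- by move=> u; split=> [[]|].
- by move=> u hu /=; rewrite chan_op_shift; vx.
- move=> u; split=> [[]|] // hu; split=> //; exact: (Rstar_app c' hu).1.
- move=> u hu; change (vscal (CofR (-1)) (app (Rstar alpha c') u) = fapp (fop_N c') u).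
  by rewrite (Rstar_app c' hu).2; vx.
- by move=> u; split=> [[]|] // hu; split=> //; exact: (Kop_app hu).1.
- by move=> u hu; exact: (Kop_app hu).2.
Qed.

End Modes.

(** * The cutoff *)

(** A difference of [p]-th powers over a bounded step has degree [p - 1], so a further factor
    [1 + t] is affordable. *)
Lemma pow_sub_bound d p : 0 <= d -> exists a, 0 <= a /\ forall t t', 0 <= t -> 0 <= t' ->
  Rabs (t' - t) <= d -> Rabs (t' ^ p - t ^ p) * (1 + t) <= a * (1 + t) ^ p.
Proof.
move=> d0; elim: p => [|p [a [a0 IH]]].
  by exists 0; split=> [|t t' _ _ _]; [lra | rewrite /= Rminus_diag Rabs_R0; lra].
exists ((1 + d) * a + d); split; first by nra.
move=> t t' ht ht' h; have := IH t t' ht ht' h => {}IH.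
have P0 : 0 <= t ^ p by exact: pow_le.
have Ple : t ^ p <= (1 + t) ^ p by apply: pow_incr; lra.
have t'le : t' <= (1 + d) * (1 + t) by have := Rle_abs (t' - t); nra.
have -> : t' ^ p.+1 - t ^ p.+1 = t' * (t' ^ p - t ^ p) + (t' - t) * t ^ p by rewrite /=; ring.
have := Rabs_triang (t' * (t' ^ p - t ^ p)) ((t' - t) * t ^ p).
rewrite !Rabs_mult (Rabs_pos_eq t') // (Rabs_pos_eq (t ^ p)) //.
move: IH; set A := Rabs (t' ^ p - t ^ p); set B := Rabs _; set E := Rabs (t' - t) => IH le.
have A0 : 0 <= A by exact: Rabs_pos.
have E0 : 0 <= E by exact: Rabs_pos.
have Q0 : 0 <= (1 + t) ^ p by lra.
have -> : ((1 + d) * a + d) * (1 + t) ^ p.+1 =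
  (1 + d) * (1 + t) * (a * (1 + t) ^ p) + d * (1 + t) ^ p * (1 + t) by rewrite /=; ring.
have h1 : t' * (A * (1 + t)) <= (1 + d) * (1 + t) * (a * (1 + t) ^ p).
  by apply: Rmult_le_compat => //; nra.
have h2 : E * t ^ p <= d * (1 + t) ^ p by apply: Rmult_le_compat.
have h3 : B * (1 + t) <= (t' * A + E * t ^ p) * (1 + t).
  by apply: Rmult_le_compat_r => //; lra.
have h4 : E * t ^ p * (1 + t) <= d * (1 + t) ^ p * (1 + t).
  by apply: Rmult_le_compat_r => //; lra.
by apply: Rle_trans h3 _; lra.
Qed.

Lemma pow_one_plus_le t p : 0 <= t -> (1 + t) ^ p <= 2 ^ p * (1 + t ^ p).
Proof.
move=> t0; have P0 : 0 <= t ^ p by exact: pow_le.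
have T0 : 0 < 2 ^ p by apply: pow_lt; lra.
case: (Rle_dec t 1) => h.
  have : (1 + t) ^ p <= 2 ^ p by apply: pow_incr; lra.
  by nra.
have : (1 + t) ^ p <= (2 * t) ^ p by apply: pow_incr; lra.
by rewrite Rpow_mult_distr; nra.
Qed.

Definition damp (eps c : R) := c / (1 + eps * c) ^ 2.

Lemma damp_ge0 eps c : 0 < eps -> 0 <= c -> 0 <= damp eps c.
Proof.
move=> e0 c0; apply: Rmult_le_pos => //; left; apply: Rinv_0_lt_compat; apply: pow_lt; nra.
Qed.

(** With denominators [D] and [D'], the difference quotient is [(1 - eps^2 c c') / (D D')^2], and
    its numerator is at most [D D'] in absolute value. The hypothesis with [eps < 1] gives
    [D <= (1 + A) D'], so [1 / D'] is traded for [1 / D]. Keeping [1 / D^2] is what later lets the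
    bound be absorbed into [damp eps c]. *)
Lemma damp_lip eps c c' A : 0 < eps < 1 -> 0 <= c -> 0 <= c' -> 0 <= A ->
  Rabs (c' - c) <= A * (1 + c') ->
  Rabs (damp eps c' - damp eps c) <= (1 + A) * (Rabs (c' - c) / (1 + eps * c) ^ 2).
Proof.
move=> [e0 e1] c0 c0' A0 h.
set D := 1 + eps * c; set D' := 1 + eps * c'.
have D1 : 1 <= D by rewrite /D; nra.
have D1' : 1 <= D' by rewrite /D'; nra.
have DD : D <= (1 + A) * D'.
  have : c - c' <= A * (1 + c') by have := Rle_abs (c - c'); rewrite Rabs_minus_sym; lra.
  move=> hc; have : eps * (c - c') <= eps * (A * (1 + c')) by apply: Rmult_le_compat_l; lra.
  have eA : 0 <= (1 - eps) * A by apply: Rmult_le_pos; lra.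
  have -> : D = eps * (c - c') + 1 + eps * c' by rewrite /D; ring.
  have -> : (1 + A) * D' = eps * (A * (1 + c')) + 1 + eps * c' + (1 - eps) * A.
    by rewrite /D'; ring.
  by move=> he; lra.
have -> : damp eps c' - damp eps c =
  (c' - c) * ((1 - eps * c * (eps * c')) / (D * D')) * (/ D * / D').
  by rewrite /damp /D /D'; field; rewrite -/D -/D'; lra.
rewrite (Rabs_mult _ (/ D * / D')) (Rabs_mult (c' - c)) (Rabs_mult (/ D)).
have q1 : Rabs ((1 - eps * c * (eps * c')) / (D * D')) <= 1.
  have DD0 : 0 < D * D' by nra.
  rewrite Rabs_mult Rabs_inv (Rabs_pos_eq (D * D')); last lra.
  apply: (Rmult_le_reg_r (D * D')) => //; rewrite Rmult_assoc Rinv_l; last lra.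
  have x0 : 0 <= eps * c by nra.
  have y0 : 0 <= eps * c' by nra.
  by rewrite Rmult_1_l Rmult_1_r; apply: Rabs_le; rewrite /D /D'; split; nra.
have i0 : 0 < / D by apply: Rinv_0_lt_compat; lra.
have i0' : 0 < / D' by apply: Rinv_0_lt_compat; lra.
rewrite (Rabs_pos_eq (/ D)); last lra; rewrite (Rabs_pos_eq (/ D')); last lra.
have q2 : / D' <= (1 + A) * / D.
  apply: (Rmult_le_reg_r (D * D')); first by nra.
  have -> : / D' * (D * D') = D by field; lra.
  have -> : (1 + A) * / D * (D * D') = (1 + A) * D' by field; lra.
  by [].
have -> : (1 + A) * (Rabs (c' - c) / D ^ 2) = Rabs (c' - c) * 1 * (/ D * ((1 + A) * / D)).
  by field; lra.
have r0 := Rabs_pos (c' - c).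
apply: Rmult_le_compat.
- by apply: Rmult_le_pos => //; exact: Rabs_pos.
- by nra.
- exact: Rmult_le_compat_l.
- by apply: Rmult_le_compat_l => //; lra.
Qed.

(** With [c = t^p], the difference times [1 + t] is at most a multiple of [(1 + c) / (1 + eps c)^2],
    which is at most [1 + damp eps c]; no power of [1 / eps] appears. *)
Lemma damp_slowly_varying d p : 0 <= d -> exists K, 0 <= K /\ forall eps t t', 0 < eps < 1 ->
  0 <= t -> 0 <= t' -> Rabs (t' - t) <= d ->
  Rabs (damp eps (t' ^ p) - damp eps (t ^ p)) * (1 + t) <= K * (1 + damp eps (t ^ p)).
Proof.
move=> d0; have [a [a0 ha]] := pow_sub_bound p d0.
pose A := a * 2 ^ p.
have A0 : 0 <= A by apply: Rmult_le_pos => //; apply: pow_le; lra.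
have hA t t' : 0 <= t -> 0 <= t' -> Rabs (t' - t) <= d ->
    Rabs (t' ^ p - t ^ p) * (1 + t) <= A * (1 + t ^ p).
  move=> h1 h2 h; apply: Rle_trans (ha _ _ h1 h2 h) _; rewrite /A Rmult_assoc.
  by apply: Rmult_le_compat_l => //; exact: pow_one_plus_le.
exists ((1 + A) * A); split; first by nra.
move=> eps t t' he h1 h2 h.
have c0 : 0 <= t ^ p by exact: pow_le.
have c0' : 0 <= t' ^ p by exact: pow_le.
have B1 := hA _ _ h1 h2 h.
(* [damp_lip] wants the bound at the other point, hence the exchange of [t] and [t']. *)
have B2 : Rabs (t' ^ p - t ^ p) <= A * (1 + t' ^ p).
  rewrite Rabs_minus_sym in h; have := hA _ _ h2 h1 h.
  by rewrite Rabs_minus_sym; have := Rabs_pos (t' ^ p - t ^ p); nra.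
have L := damp_lip he c0 c0' A0 B2.
have D1 : 1 <= (1 + eps * t ^ p) ^ 2 by apply: pow_R1_Rle; nra.
have i0 : 0 < / (1 + eps * t ^ p) ^ 2 by apply: Rinv_0_lt_compat; lra.
have i1 : / (1 + eps * t ^ p) ^ 2 <= 1 by rewrite -Rinv_1; apply: Rinv_le_contravar; lra.
apply: (@Rle_trans _ ((1 + A) * (Rabs (t' ^ p - t ^ p) / (1 + eps * t ^ p) ^ 2) * (1 + t))).
  by apply: Rmult_le_compat_r L; lra.
rewrite /damp /Rdiv; set i := / _ in i0 i1 *; set r := Rabs _ in B1 *.
have -> : (1 + A) * (r * i) * (1 + t) = (1 + A) * ((r * (1 + t)) * i) by ring.
rewrite [X in _ <= X]Rmult_assoc; apply: Rmult_le_compat_l; first lra.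
apply: Rle_trans (_ : A * (1 + t ^ p) * i <= _); first by apply: Rmult_le_compat_r => //; lra.
by rewrite Rmult_assoc; apply: Rmult_le_compat_l => //; nra.
Qed.

(** The square in the denominator of [damp] offers one factor for [1 + t^p] and one for [t^p]; each
    quotient is at most [1 / eps]. *)
Lemma damp_bounded eps p : 0 < eps < 1 -> exists M, 0 <= M /\ forall t, 0 <= t ->
  damp eps (t ^ p) * (1 + t) ^ p <= M.
Proof.
move=> [e0 e1]; have T0 : 0 <= 2 ^ p by apply: pow_le; lra.
exists (2 ^ p * (/ eps * / eps)).
have i0 : 0 < / eps by exact: Rinv_0_lt_compat.
split; first by nra.
move=> t t0; have c0 : 0 <= t ^ p by exact: pow_le.
apply: Rle_trans (Rmult_le_compat_l _ _ _ (damp_ge0 e0 c0) (pow_one_plus_le p t0)) _.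
rewrite (Rmult_comm (damp _ _)) Rmult_assoc; apply: Rmult_le_compat_l => //.
have D1 : 1 <= 1 + eps * t ^ p by nra.
have -> : (1 + t ^ p) * damp eps (t ^ p) =
  ((1 + t ^ p) / (1 + eps * t ^ p)) * (t ^ p / (1 + eps * t ^ p)).
  by rewrite /damp; field; lra.
have j0 : 0 < / (1 + eps * t ^ p) by apply: Rinv_0_lt_compat; lra.
apply: Rmult_le_compat; try by apply: Rmult_le_pos; lra.
  apply: (Rmult_le_reg_r (eps * (1 + eps * t ^ p))); first by nra.
  have -> : / eps * (eps * (1 + eps * t ^ p)) = 1 + eps * t ^ p by field; lra.
  have -> : (1 + t ^ p) / (1 + eps * t ^ p) * (eps * (1 + eps * t ^ p)) = eps * (1 + t ^ p).
    by field; lra.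
  by nra.
apply: (Rmult_le_reg_r (eps * (1 + eps * t ^ p))); first by nra.
have -> : / eps * (eps * (1 + eps * t ^ p)) = 1 + eps * t ^ p by field; lra.
have -> : t ^ p / (1 + eps * t ^ p) * (eps * (1 + eps * t ^ p)) = eps * t ^ p by field; lra.
by lra.
Qed.

(** * Forms weighted by the cutoff *)

Section WeightedForms.
Variables (X : Type) (N : X -> R) (p : nat).
Hypothesis N0 : forall x, 0 <= N x.
Implicit Types (u v w : Vec X).

Lemma pairable_scal z v w : pairable v w -> pairable v (vscal z w).
Proof.
move=> h; have := summC_scal z h; rewrite /pairable.
by have -> : (fun x => Cmul z (Cmul (Cconj (v x)) (w x))) =
  (fun x => Cmul (Cconj (v x)) (vscal z w x)) by vx.
Qed.

Lemma pairable_add v w w' : pairable v w -> pairable v w' -> pairable v (vadd w w').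
Proof.
move=> h h'; have := summC_add h h'; rewrite /pairable.
by have -> : (fun x => Cadd (Cmul (Cconj (v x)) (w x)) (Cmul (Cconj (v x)) (w' x))) =
  (fun x => Cmul (Cconj (v x)) (vadd w w' x)) by vx.
Qed.

Lemma pairable_zero v : pairable v (@vzero X).
Proof. by split; apply: (@summ_finsupp _ _ [::]) => x _ /=; ring. Qed.

Lemma pairable_fapp A v u : (forall t, List.In t A -> pairable v (act t.2 u)) ->
  pairable v (fapp A u).
Proof.
elim: A => [|t A IH] h /=; first exact: pairable_zero.
apply: pairable_add; first by apply: pairable_scal; apply: h; left.
by apply: IH => s hs; apply: h; right.
Qed.

Variables (eps M : R).
Hypothesis heps : 0 < eps < 1.
Hypothesis M0 : 0 <= M.
Hypothesis hM : forall t, 0 <= t -> damp eps (t ^ p) * (1 + t) ^ p <= M.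

Definition cutoff x := damp eps (N x ^ p).
(** This is [<u | C_eps u> + ||u||^2], the right side of (b) with equal constants, kept as one
    series. *)
Definition cutoff_form u := psum (fun x => (1 + cutoff x) * Cnorm2 (u x)).

Lemma cutoff_ge0 x : 0 <= cutoff x.
Proof. by apply: damp_ge0; [lra | apply: pow_le]. Qed.

Lemma cutoff_pow_le x : cutoff x * (1 + N x) ^ p <= M.
Proof. exact: hM. Qed.

Lemma cutoff_le x : cutoff x <= M.
Proof.
apply: Rle_trans (cutoff_pow_le x); have := cutoff_ge0 x.
have := @pow_R1_Rle (1 + N x) p ltac:(have := N0 x; lra); nra.
Qed.

Lemma inL2_cutoff u : inL2 u -> inL2 (mul_diag cutoff u).
Proof.
apply: (@inL2_diag _ (M * M)) => x; have := cutoff_le x; have := cutoff_ge0 x; nra.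
Qed.

(** [act S u] itself may fail to be square summable. The squared weight of the composite has two
    cutoff factors: one absorbs [(1 + N)^p], the other is at most [M], leaving a shift of degree
    0. *)
Lemma inL2_cutoff_act S d u : graded N S d p -> inL2 u -> inL2 (mul_diag cutoff (act S u)).
Proof.
move=> [h1 h2 [K [K0 hK]]] hu.
have gr : graded N (scomp (sdiag cutoff) S) (0 + d) 0.
  split; first exact: lawful_scomp.
    move=> x /= hx; rewrite Rplus_0_l; apply: h2 => e; apply: hx; rewrite e; ring.
  exists (K * (M * M)); split; first by apply: Rmult_le_pos => //; nra.
  move=> x /=; rewrite Rmult_1_r.
  have -> : cutoff x * cf S x * (cutoff x * cf S x) =
    (cf S x * cf S x) * (cutoff x * cutoff x) by ring.
  have f0 := cutoff_ge0 x; have fM := cutoff_le x; have fpM := cutoff_pow_le x.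
  apply: Rle_trans (_ : K * (1 + N x) ^ p * (cutoff x * cutoff x) <= _).
    by apply: Rmult_le_compat_r (hK x); nra.
  rewrite Rmult_assoc; apply: Rmult_le_compat_l => //.
  have -> : (1 + N x) ^ p * (cutoff x * cutoff x) = (cutoff x * (1 + N x) ^ p) * cutoff x by ring.
  apply: Rmult_le_compat => //; apply: Rmult_le_pos => //.
  by apply: pow_le; have := N0 x; lra.
have [K' [_ hK']] := act_bound N0 gr.
have [|h _] := hK' u; first by apply: sums_bounded_le hu => x /=; lra.
by rewrite -act_sdiag -act_scomp.
Qed.

Lemma pairable_cutoff_act S d u v : graded N S d p -> inL2 v -> inL2 u ->
  pairable (mul_diag cutoff v) (act S u).
Proof.
move=> gS hv hu; have := pairable_L2 hv (inL2_cutoff_act gS hu); rewrite /pairable.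
have -> // : (fun x => Cmul (Cconj (v x)) (mul_diag cutoff (act S u) x)) =
  (fun x => Cmul (Cconj (mul_diag cutoff v x)) (act S u x)) by vx.
Qed.

(** A shift that conserves [N] commutes with the cutoff, so moving it across the inner product only
    conjugates the value. *)
Lemma Re_inner_conserved S u : graded N S 0 p ->
  Re (inner (mul_diag cutoff u) (act S u)) = Re (inner (mul_diag cutoff u) (act (sadj S) u)).
Proof.
move=> gS; have [_ hN _] := graded_sadj N0 gS.
rewrite inner_act; last by case: gS.
rewrite -inner_diag Re_inner_sym; congr (Re (inner _ _)).
apply: functional_extensionality => y; rewrite /act /mul_diag.
case: (excluded_middle_informative (cf (sadj S) y = 0)) => [->|h]; first cx.
have -> : cutoff (sg (sadj S) y) = cutoff y by rewrite /cutoff hN //; congr (damp _ (_ ^ _)); ring.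
cx.
Qed.

Lemma cutoff_form_bounded u : inL2 u -> sums_bounded (fun x => (1 + cutoff x) * Cnorm2 (u x)).
Proof.
move=> hu; have M1 : 0 <= 1 + M by lra.
apply: sums_bounded_le (sums_bounded_scal M1 hu) => x.
by apply: Rmult_le_compat_r; [exact: Cnorm2_ge0 | have := cutoff_le x; lra].
Qed.

Lemma cutoff_form_ge0 u : inL2 u -> 0 <= cutoff_form u.
Proof. by move=> hu; apply: psum_ge0; exact: cutoff_form_bounded. Qed.

Lemma cutoff_formE u : inL2 u ->
  cutoff_form u = Re (inner u (mul_diag cutoff u)) + norm u ^ 2.
Proof.
move=> hu; rewrite norm_sqr // /inner /sumC /=.
have -> : (fun x => Re (u x) * (cutoff x * Re (u x) - 0 * Im (u x)) -
    - Im (u x) * (cutoff x * Im (u x) + 0 * Re (u x))) = (fun x => cutoff x * Cnorm2 (u x)).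
  by apply: functional_extensionality => x; rewrite /Cnorm2; ring.
have f0 x : 0 <= cutoff x * Cnorm2 (u x).
  by apply: Rmult_le_pos; [exact: cutoff_ge0 | exact: Cnorm2_ge0].
have bf : sums_bounded (fun x => cutoff x * Cnorm2 (u x)).
  apply: sums_bounded_le (cutoff_form_bounded hu) => x; have := Cnorm2_ge0 (u x); lra.
rewrite sumR_ge0E // -psum_add //; last by move=> x; exact: Cnorm2_ge0.
by congr psum; apply: functional_extensionality => x; ring.
Qed.

(** The factor [1 + cf^2] dominates both [cf^2], met in the dissipation, and [|cf|], met in the
    coupling. Both end points are needed because the coupling pairs a vector at [sg S x] with
    another at [x]. *)
Definition slow (S : shift X) (K : R) := forall x, cf S x <> 0 ->
  Rabs (cutoff x - cutoff (sg S x)) * (1 + cf S x * cf S x) <= K * (1 + cutoff x) /\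
  Rabs (cutoff x - cutoff (sg S x)) * (1 + cf S x * cf S x) <= K * (1 + cutoff (sg S x)).

Variables (S : shift X) (d K : R).
Hypothesis gS : graded N S d p.
Hypothesis K0 : 0 <= K.
Hypothesis hK : slow S K.

Lemma summ_cutoff_df u : inL2 u ->
  summ (fun y => cutoff y * (df S y * df S y) * Cnorm2 (u y)) /\
  summ (fun y => cutoff (tu S y) * (df S y * df S y) * Cnorm2 (u y)).
Proof.
move=> hu; have [[_ h2] _ [K1 [K10 hK1]]] := gS.
have [_ _ [K2 [K20 hK2]]] := graded_sadj N0 gS.
have gen (h : X -> R) Kh : 0 <= Kh -> (forall y, Rabs (h y) <= Kh) ->
    summ (fun y => h y * Cnorm2 (u y)).
  move=> Kh0 hh; apply: summ_le (sums_bounded_scal Kh0 hu) => y.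
  rewrite Rabs_mult (Rabs_pos_eq (Cnorm2 _)); last exact: Cnorm2_ge0.
  by apply: Rmult_le_compat_r => //; exact: Cnorm2_ge0.
have bnd x r K' : 0 <= K' -> 0 <= r -> r <= K' * (1 + N x) ^ p -> Rabs (cutoff x * r) <= K' * M.
  move=> K'0 r0 hr; rewrite Rabs_pos_eq; last by apply: Rmult_le_pos => //; exact: cutoff_ge0.
  apply: Rle_trans (Rmult_le_compat_l _ _ _ (cutoff_ge0 x) hr) _.
  apply: Rle_trans (_ : K' * (cutoff x * (1 + N x) ^ p) <= _); first by right; ring.
  by apply: Rmult_le_compat_l => //; exact: cutoff_pow_le.
split.
  apply: (gen _ (K2 * M)) => [|y]; first exact: Rmult_le_pos.
  by apply: bnd => //; [nra | exact: hK2].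
(* Here the cutoff sits at [tu S y], so the squared weight is rewritten as [cf] at that point before
   being bounded. *)
apply: (gen _ (K1 * M)) => [|y]; first exact: Rmult_le_pos.
case: (excluded_middle_informative (df S y = 0)) => [->|/h2 [e1 e2]].
  by rewrite !Rmult_0_r Rabs_R0; exact: Rmult_le_pos.
by rewrite -e1; apply: bnd => //; nra.
Qed.

(** After reindexing, both terms are sums over the coordinates of [u], and their difference has the
    weight [(cutoff (tu S y) - cutoff y) * df^2]. *)
Lemma dissipation_bound z u : inL2 u ->
  Re (inner (vscal z (act S u)) (mul_diag cutoff (vscal z (act S u)))) -
  Cnorm2 z * Re (inner (mul_diag cutoff u) (act (scomp (sadj S) S) u))
  <= K * (Cnorm2 z * cutoff_form u).
Proof.
move=> hu; have [[h1 h2] _ _] := gS.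
have [s1 s2] := summ_cutoff_df hu; have z0 := Cnorm2_ge0 z.
have -> : Re (inner (vscal z (act S u)) (mul_diag cutoff (vscal z (act S u)))) =
    Cnorm2 z * sumR (fun y => cutoff (tu S y) * (df S y * df S y) * Cnorm2 (u y)).
  rewrite -sumR_scal //.
  have -> : Re (inner (vscal z (act S u)) (mul_diag cutoff (vscal z (act S u)))) =
    sumR (fun x => Cnorm2 z * (cutoff x * (cf S x * cf S x) * Cnorm2 (u (sg S x)))).
    rewrite /=; congr sumR; apply: functional_extensionality => x.
    by rewrite /= /Cnorm2; ring.
  apply: (@sumR_matched _ (sg S) (tu S)); split=> x hx.
    have /h1 [-> ->] : cf S x <> 0 by move=> e; apply: hx; rewrite e; ring.
    by [].
  by have /h2 [-> ->] : df S x <> 0 by move=> e; apply: hx; rewrite e; ring.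
have -> : Re (inner (mul_diag cutoff u) (act (scomp (sadj S) S) u)) =
    sumR (fun y => cutoff y * (df S y * df S y) * Cnorm2 (u y)).
  rewrite /=; congr sumR; apply: functional_extensionality => y /=.
  case: (excluded_middle_informative (df S y = 0)) => [->|/h2 [-> ->]]; first ring.
  by rewrite /Cnorm2; ring.
rewrite -Rmult_minus_distr_l -sumR_sub //.
have -> : K * (Cnorm2 z * cutoff_form u) = Cnorm2 z * (K * cutoff_form u) by ring.
apply: Rmult_le_compat_l => //; have bu := cutoff_form_bounded hu.
rewrite /cutoff_form -psum_scal //.
have P y : 0 <= (1 + cutoff y) * Cnorm2 (u y).
  by apply: Rmult_le_pos; [have := cutoff_ge0 y; lra | exact: Cnorm2_ge0].
apply: sumR_le_psum; last exact: sums_bounded_scal.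
- have := summ_add s2 (summ_scal (-1) s1).
  by apply: sums_bounded_le => y; right; congr Rabs; ring.
- move=> y; rewrite -Rmult_minus_distr_r -[X in _ <= X]Rmult_assoc -Rmult_minus_distr_r.
  apply: Rmult_le_compat_r; first exact: Cnorm2_ge0.
  case: (excluded_middle_informative (df S y = 0)) => [->|dy].
    by rewrite !Rmult_0_r; apply: Rmult_le_pos => //; have := cutoff_ge0 y; lra.
  have [e1 e2] := h2 _ dy; have [|_] := hK (x := tu S y); first by rewrite e1.
  rewrite e1 e2; apply: Rle_trans.
  have := Rle_abs (cutoff (tu S y) - cutoff y); have := Rabs_pos (cutoff (tu S y) - cutoff y); nra.
- by move=> y; apply: Rmult_le_pos.
Qed.

(** Brought to the index of [w], the two terms differ only in sign and in where the cutoff is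
    evaluated. Their sum is controlled by a cutoff difference, and [|a w| <= (|a|^2 + |w|^2) / 2]
    separates the vectors. *)
Lemma coupling_bound z u w : inL2 u -> inL2 w ->
  inL2 (vscal z (act S u)) -> inL2 (vscal (Cmul (CofR (-1)) (Cconj z)) (act (sadj S) w)) ->
  Re (inner u (mul_diag cutoff (vscal (Cmul (CofR (-1)) (Cconj z)) (act (sadj S) w)))) +
  Re (inner (vscal z (act S u)) (mul_diag cutoff w))
  <= K * ((Cnorm2 z * cutoff_form u + cutoff_form w) / 2).
Proof.
move=> hu hw hR hN; have [[h1 h2] _ _] := gS; have z0 := Cnorm2_ge0 z.
pose f1 y := Re (Cmul (Cconj (u y))
  (mul_diag cutoff (vscal (Cmul (CofR (-1)) (Cconj z)) (act (sadj S) w)) y)).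
pose f2 x := - (cutoff (sg S x) * cf S x * Re (Cmul (Cconj (Cmul z (u (sg S x)))) (w x))).
pose f3 x := Re (Cmul (Cconj (vscal z (act S u) x)) (mul_diag cutoff w x)).
have m : matched 0 (tu S) (sg S) f1 f2.
  split=> x hx.
    have /h2 [e1 e2] : df S x <> 0.
      by move=> e; apply: hx; rewrite /f1 /mul_diag /vscal /act /= e; ring.
    by split=> //; rewrite /f1 /f2 /mul_diag /vscal /act /= e2 e1; ring.
  have /h1 [e1 e2] : cf S x <> 0 by move=> e; apply: hx; rewrite /f2 e; ring.
  by split=> //; rewrite /f1 /f2 /mul_diag /vscal /act /= e2 e1; ring.
have s1 : summ f1 := (pairable_L2 hu (inL2_cutoff hN)).1.
have s3 : summ f3 := (pairable_L2 hR (inL2_cutoff hw)).1.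
have s2 : summ f2.
  by apply: (sums_bounded_matched (matched_sym (matched_comp (h := Rabs) Rabs_R0 m))); exact: s1.
have -> : Re (inner u (mul_diag cutoff (vscal (Cmul (CofR (-1)) (Cconj z)) (act (sadj S) w)))) = sumR f2.
  by rewrite -(sumR_matched m).
rewrite -[Re (inner _ _)]/(sumR f3) -sumR_add //.
(* [sg] may be non-injective off the support of [cf], so the series in [u (sg S x)] is restricted to
   that support; otherwise some coordinates of [u] would be counted repeatedly. *)
pose ind (r s : R) := if excluded_middle_informative (r = 0) then 0 else s.
pose g1 x := ind (cf S x) ((1 + cutoff (sg S x)) * Cnorm2 (u (sg S x))).
pose g2 x := ind (df S x) ((1 + cutoff x) * Cnorm2 (u x)).
have ind0 s : ind 0 s = 0 by rewrite /ind; case: excluded_middle_informative.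
have ind1 r s : r <> 0 -> ind r s = s by rewrite /ind; case: excluded_middle_informative.
have P x c : 0 <= (1 + cutoff x) * Cnorm2 c.
  by apply: Rmult_le_pos; [have := cutoff_ge0 x; lra | exact: Cnorm2_ge0].
have ind_le r s : 0 <= s -> 0 <= ind r s <= s.
  by rewrite /ind => hs; case: excluded_middle_informative => ? /=; lra.
have mg : matched 0 (sg S) (tu S) g1 g2.
  split=> x hx.
    have cx : cf S x <> 0 by move=> e; apply: hx; rewrite /g1 e ind0.
    by have [e1 e2] := h1 _ cx; split=> //; rewrite /g1 /g2 !ind1 ?e1.
  have dx : df S x <> 0 by move=> e; apply: hx; rewrite /g2 e ind0.
  by have [e1 e2] := h2 _ dx; split=> //; rewrite /g1 /g2 !ind1 ?e1 // e2.
have bu := cutoff_form_bounded hu; have bw := cutoff_form_bounded hw.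
have le2 x : g2 x <= (1 + cutoff x) * Cnorm2 (u x) by exact: (ind_le _ _ (P _ _)).2.
have b2 := sums_bounded_le le2 bu.
have b1 := sums_bounded_matched mg b2.
have g10 x : 0 <= g1 x by exact: (ind_le _ _ (P _ _)).1.
have e1 : psum g1 <= cutoff_form u by rewrite (psum_matched mg); exact: psum_le.
have K2 : 0 <= K / 2 by lra.
have Kz : 0 <= K / 2 * Cnorm2 z by exact: Rmult_le_pos.
apply: (@Rle_trans _ (psum (fun x => K / 2 * Cnorm2 z * g1 x + K / 2 * ((1 + cutoff x) * Cnorm2 (w x))))).
  apply: sumR_le_psum.
  - exact: summ_add.
  - move=> x; rewrite /f2 /f3 /g1.
    case: (excluded_middle_informative (cf S x = 0)) => [e|cx].
      have -> : - (cutoff (sg S x) * cf S x * Re (Cmul (Cconj (Cmul z (u (sg S x)))) (w x))) +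
        Re (Cmul (Cconj (vscal z (act S u) x)) (mul_diag cutoff w x)) = 0.
        by rewrite /vscal /act /mul_diag /= e; ring.
      rewrite e ind0 Rmult_0_r Rplus_0_l; exact: Rmult_le_pos.
    rewrite ind1 //; have [k1 k2] := hK cx.
    set a := Cmul z (u (sg S x)).
    have -> : - (cutoff (sg S x) * cf S x * Re (Cmul (Cconj a) (w x))) +
        Re (Cmul (Cconj (vscal z (act S u) x)) (mul_diag cutoff w x)) =
        (cutoff x - cutoff (sg S x)) * cf S x * Re (Cmul (Cconj a) (w x)).
      by rewrite /a /vscal /act /mul_diag /=; ring.
    apply: Rle_trans (Rle_abs _) _; rewrite !Rabs_mult.
    have ha := Re_conj_mul_bound a (w x).
    have na : Cnorm2 a = Cnorm2 z * Cnorm2 (u (sg S x)) by rewrite Cnorm2_mul.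
    have n1 := Cnorm2_ge0 a; have n2 := Cnorm2_ge0 (w x).
    have cle : Rabs (cf S x) <= 1 + cf S x * cf S x.
      by rewrite /Rabs; case: Rcase_abs => _; nra.
    move: k1 k2 ha cle; set D := Rabs (_ - _); set c := Rabs (cf S x); set r := Rabs _.
    move=> k1 k2 ha cle.
    have D0 : 0 <= D by exact: Rabs_pos.
    have r0 : 0 <= r by exact: Rabs_pos.
    have Dc0 : 0 <= D * c by apply: Rmult_le_pos => //; exact: Rabs_pos.
    have Dc : D * c <= D * (1 + cf S x * cf S x) by exact: Rmult_le_compat_l.
    have -> : K / 2 * Cnorm2 z * ((1 + cutoff (sg S x)) * Cnorm2 (u (sg S x))) =
      (K * (1 + cutoff (sg S x))) * Cnorm2 a / 2 by rewrite na; field.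
    have -> : K / 2 * ((1 + cutoff x) * Cnorm2 (w x)) = (K * (1 + cutoff x)) * Cnorm2 (w x) / 2.
      by field.
    have q1 : D * c * Cnorm2 a <= K * (1 + cutoff (sg S x)) * Cnorm2 a.
      by apply: Rmult_le_compat_r => //; lra.
    have q2 : D * c * Cnorm2 (w x) <= K * (1 + cutoff x) * Cnorm2 (w x).
      by apply: Rmult_le_compat_r => //; lra.
    have q3 : D * c * r <= D * c * ((Cnorm2 a + Cnorm2 (w x)) / 2).
      exact: Rmult_le_compat_l.
    by lra.
  - by move=> x; have := Rmult_le_pos _ _ Kz (g10 x); have := Rmult_le_pos _ _ K2 (P x (w x)); lra.
  - by apply: sums_bounded_add; apply: sums_bounded_scal.
rewrite psum_add; last 2 first.
- exact: sums_bounded_scal.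
- exact: sums_bounded_scal.
- rewrite !psum_scal // -/(cutoff_form w).
  by have := Rmult_le_compat_l _ _ _ Kz e1; lra.
- by move=> x; exact: Rmult_le_pos.
- by move=> x; exact: Rmult_le_pos.
Qed.

End WeightedForms.

(** * The quadratic form *)

Section FiniteSums.
Variable T : finType.
Implicit Types f h : T -> R.

Lemma Re_fsumC (h : T -> Cx) : Re (fsumC h) = fsumR (fun t => Re (h t)).
Proof. by rewrite /fsumC /fsumR; elim: (enum T) => //= t l ->. Qed.

Lemma fsumR_add f h : fsumR (fun t => f t + h t) = fsumR f + fsumR h.
Proof. by rewrite /fsumR; elim: (enum T) => /= [|t l ->]; ring. Qed.

Lemma fsumR_scal a f : fsumR (fun t => a * f t) = a * fsumR f.
Proof. by rewrite /fsumR; elim: (enum T) => /= [|t l ->]; ring. Qed.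

Lemma fsumR_zero : fsumR (fun _ : T => 0) = 0.
Proof. by rewrite /fsumR; elim: (enum T) => /= [|t l ->]; ring. Qed.

Lemma fsumR_le f h : (forall t, f t <= h t) -> fsumR f <= fsumR h.
Proof. by move=> le; rewrite /fsumR; elim: (enum T) => /= [|t l IH]; [lra | have := le t; lra]. Qed.

Lemma fsumR_option (f : option T -> R) : fsumR f = f None + fsumR (fun t => f (Some t)).
Proof.
rewrite /fsumR enumT [in LHS]unlock /= -enumT; congr (_ + _).
by elim: (enum T) => //= t l ->.
Qed.

Lemma uniform_constant (P : T -> R -> Prop) :
  (forall t K K', K <= K' -> P t K -> P t K') ->
  (forall t, exists K, 0 <= K /\ P t K) -> exists K, 0 <= K /\ forall t, P t K.
Proof.
move=> mono ex.
have [K [K0 hK]] : exists K, 0 <= K /\ forall t, t \in enum T -> P t K.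
  elim: (enum T) => [|t l [K [K0 hK]]]; first by exists 0; split=> //; exact: Rle_refl.
  have [K' [K0' hK']] := ex t; exists (K + K'); split; first lra.
  move=> s; rewrite inE => /orP[/eqP ->|/hK h]; [apply: mono hK' | apply: mono h]; lra.
by exists K; split=> // t; apply: hK; rewrite mem_enum.
Qed.

End FiniteSums.

(** Degree 1 is exactly what the factor [1 + t] in [damp_slowly_varying] absorbs. *)
Lemma graded_slow (X : Type) (N : X -> R) (N0 : forall x, 0 <= N x) S d p :
  graded N S d 1 -> exists K, 0 <= K /\ forall eps, 0 < eps < 1 -> slow N p eps S K.
Proof.
move=> [_ hN [k [k0 hk]]]; have a0 := Rabs_pos d.
have [K [K0 hK]] := damp_slowly_varying p a0.
exists ((1 + k) * ((1 + Rabs d) * K)); split.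
  by apply: Rmult_le_pos; [lra | apply: Rmult_le_pos; lra].
move=> eps he x cx; have eN := hN x cx; have n0 := N0 x; have n1 := N0 (sg S x).
have ck : 1 + cf S x * cf S x <= (1 + k) * (1 + N x).
  by have := hk x; rewrite pow_1; nra.
have h1 : Rabs (N (sg S x) - N x) <= Rabs d by rewrite eN; right; congr Rabs; ring.
have h2 := h1; rewrite Rabs_minus_sym in h2.
have e1 := hK _ _ _ he n0 n1 h1; have e2 := hK _ _ _ he n1 n0 h2.
rewrite Rabs_minus_sym in e1.
rewrite -/(cutoff N p eps x) -/(cutoff N p eps (sg S x)) in e1 e2.
have f0 := cutoff_ge0 p N0 he x; have f1 := cutoff_ge0 p N0 he (sg S x).
move: e1 e2; set D := Rabs _ => e1 e2.
have D0 : 0 <= D by exact: Rabs_pos.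
have le : D * (1 + cf S x * cf S x) <= (1 + k) * (D * (1 + N x)).
  by have := Rmult_le_compat_l _ _ _ D0 ck; lra.
(* The squared weight is bounded by the energy at [x]; for the second inequality it is transported
   to [sg S x] at this cost. *)
have nn : 1 + N x <= (1 + Rabs d) * (1 + N (sg S x)).
  by rewrite eN in n1 *; have := Rle_abs (- d); rewrite Rabs_Ropp; nra.
have le2 : D * (1 + N x) <= (1 + Rabs d) * (D * (1 + N (sg S x))).
  by have := Rmult_le_compat_l _ _ _ D0 nn; lra.
have Kf : 0 <= K * (1 + cutoff N p eps x) by apply: Rmult_le_pos; lra.
split; apply: Rle_trans le _; rewrite Rmult_assoc; apply: Rmult_le_compat_l; try lra.
  by nra.
by apply: Rle_trans le2 _; rewrite Rmult_assoc; apply: Rmult_le_compat_l; lra.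
Qed.

Lemma inner_fapp_expand (X : Type) (A : fop X) (v u : Vec X) :
  (forall t, List.In t A -> pairable v (act t.2 u)) ->
  inner v (fapp A u) = foldr (fun t acc => Cadd (Cmul t.1 (inner v (act t.2 u))) acc) C0 A.
Proof.
elim: A => [|t A IH] h /=; first exact: inner_zero_r.
have h1 : pairable v (act t.2 u) by apply: h; left.
have h2 s : List.In s A -> pairable v (act s.2 u) by move=> hs; apply: h; right.
rewrite inner_add_r ?inner_scal_r ?IH //; first exact: pairable_scal.
exact: pairable_fapp.
Qed.

Lemma fapp_single (X : Type) z (S : shift X) u : fapp [:: (z, S)] u = vscal z (act S u).
Proof. by rewrite /=; vx. Qed.

Lemma mul_diag_vzero (X : Type) (c : X -> R) : mul_diag c (@vzero X) = @vzero X.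
Proof. by vx. Qed.

Lemma inner_zero_l (X : Type) (v : Vec X) : inner (@vzero X) v = C0.
Proof. by rewrite -(inner_zero_r v) /inner; congr sumC; vx. Qed.

(** * The form inequality (b) *)

Section Estimate.
Variables (n m : nat) (ws : 'I_n -> R) (wp : 'I_m -> R).
Hypothesis hws : forall i, 0 < ws i.
Hypothesis hwp : forall j, 0 < wp j.
Hypothesis hsum : fsumR ws = fsumR wp.
Variables (g : R) (alpha : chan n m -> Cx) (p : nat).
Hypothesis hp : (n + m <= p)%N.
Hypothesis hp2 : (2 <= p)%N.
Local Notation V := (Vec (Idx n m)).
Local Notation Nv := (Nval ws wp).
Local Notation F := (fop_F ws wp g alpha).
Local Notation N0 := (Nval_ge0 hws hwp).

Variables (eps M K : R).
Hypothesis heps : 0 < eps < 1.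
Hypothesis M0 : 0 <= M.
Hypothesis hM : forall t, 0 <= t -> damp eps (t ^ p) * (1 + t) ^ p <= M.
Hypothesis K0 : 0 <= K.
Hypothesis hK : forall c, slow Nv p eps (chan_shift (n := n) (m := m) c) K.
Local Notation f := (cutoff Nv p eps).
Local Notation Q := (cutoff_form Nv p eps).

Lemma Re_inner_generator (u : V) : inL2 u ->
  Re (inner (mul_diag f u) (fapp (fop_K ws wp g alpha) u)) =
  -1 / 2 * fsumR (fun c => Cnorm2 (alpha c) *
    Re (inner (mul_diag f u) (act (scomp (sadj (chan_shift c)) (chan_shift c)) u))).
Proof.
move=> hu; have gK := all_graded_fop_F hws hwp hsum g alpha hp hp2 None None.
rewrite inner_fapp_expand; last first.
  move=> t ht; have [d gt] := (List.Forall_forall _ _).1 gK _ ht.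
  exact: (pairable_cutoff_act N0 heps hM gt).
have gW := graded_le N0 hp (graded_shift_W hws hwp hsum).
have W := Re_inner_conserved N0 eps u gW.
have I0 : Im (inner (mul_diag f u) (act (sdiag Nv) u)) = 0.
  rewrite -[RHS](sumR_zero (Idx n m)) /inner /=; congr sumR.
  by apply: functional_extensionality => x /=; ring.
rewrite /fop_K.
set B := fop_damping _ _.
set G := fun t acc => _.
(* The energy term is [-i] times a real number; the interaction terms have opposite coefficients
   and, by [W], equal real parts. *)
have -> : Re (foldr G C0 [:: (Copp Ci, sdiag Nv), (CofR (g / 2), shift_W n m),
    (CofR (- (g / 2)), sadj (shift_W n m)) & B]) = Re (foldr G C0 B).
  have cancel a b c r : Re a = Re b -> Im c = 0 -> Re (Cadd (Cmul (Copp Ci) c)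
      (Cadd (Cmul (CofR (g / 2)) a) (Cadd (Cmul (CofR (- (g / 2))) b) r))) = Re r.
    by move=> e0 e1 /=; rewrite e0 e1; ring.
  exact: cancel W I0.
set D := fun c => Cnorm2 (alpha c) * _.
rewrite /B /fop_damping /fsumR {W I0 gK B}.
elim: (enum _) => [|c l IH]; first by rewrite /=; ring.
have stepD : foldr (fun t acc => D t + acc) 0 (c :: l) = D c + foldr (fun t acc => D t + acc) 0 l by [].
have step r z (q : R) : Re (Cadd (Cmul (CofR q) z) r) = q * Re z + Re r by rewrite /=; ring.
by rewrite [foldr G _ _]/(Cadd (Cmul (CofR _) _) (foldr G _ _)) step IH
  stepD Rmult_assoc -/(D c); ring.
Qed.

Variable u : option (chan n m) -> V.
Hypothesis hu : forall i, inL2 (u i).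
Hypothesis hF : forall i j, inL2 (fapp (F i j) (u j)).

(** The two conjugate terms of [K] each give the damping sum with [-1/2], hence one full negative
    copy to set against the terms quadratic in the channels. *)
Lemma generator_bound :
  Re (inner (u None) (mul_diag f (fapp (F None None) (u None)))) +
  Re (inner (fapp (F None None) (u None)) (mul_diag f (u None))) +
  fsumR (fun c => Re (inner (fapp (F (Some c) None) (u None))
                            (mul_diag f (fapp (F (Some c) None) (u None)))))
  <= K * (fsumR (fun c => Cnorm2 (alpha c)) * Q (u None)).
Proof.
rewrite [X in _ + X + _]Re_inner_sym !inner_diag Re_inner_generator //.
set D := fun c => _.
have -> : K * (fsumR (fun c => Cnorm2 (alpha c)) * Q (u None)) =
    fsumR (fun c => K * (Cnorm2 (alpha c) * Q (u None))).
  rewrite (Rmult_comm _ (Q _)) -!fsumR_scal; congr fsumR.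
  by apply: functional_extensionality => c; ring.
have le : fsumR (fun c => Re (inner (fapp (F (Some c) None) (u None))
     (mul_diag f (fapp (F (Some c) None) (u None)))) + -1 * D c) <=
  fsumR (fun c => K * (Cnorm2 (alpha c) * Q (u None))).
  apply: fsumR_le => c; rewrite /fop_F /fop_R fapp_single.
  have [d gc] := graded_chan_shift hws hwp c.
  have gcp := graded_le N0 (leq_trans (isT : (1 <= 2)%N) hp2) gc.
  have := dissipation_bound N0 heps M0 hM gcp K0 (@hK c) (alpha c) (hu None).
  by rewrite /D; lra.
move: le; rewrite fsumR_add fsumR_scal => le.
lra.
Qed.

Lemma noise_bound c :
  Re (inner (u None) (mul_diag f (fapp (F None (Some c)) (u (Some c))))) +
  Re (inner (fapp (F (Some c) None) (u None)) (mul_diag f (u (Some c))))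
  <= K * ((Cnorm2 (alpha c) * Q (u None) + Q (u (Some c))) / 2).
Proof.
have h1 := hF (Some c) None; have h2 := hF None (Some c).
rewrite /fop_F /fop_R /fop_N !fapp_single in h1 h2 *.
have [d gc] := graded_chan_shift hws hwp c.
have gcp := graded_le N0 (leq_trans (isT : (1 <= 2)%N) hp2) gc.
exact: (coupling_bound N0 heps M0 hM gcp K0 (@hK c) (hu None) (hu (Some c)) h1 h2).
Qed.

(** With [A] the sum of the [|alpha|^2] and [S] the sum of the forms at positive indices, the corner
    costs [K A Q(u_0)] and the first row and column [K/2 (A Q(u_0) + S)] each. The total
    [K (2 A Q(u_0) + S)] explains the factor [1 + 2 A]. *)
Lemma quadratic_form_bound :
  fsumR (fun i => fsumR (fun j =>
    Re (inner (u i) (mul_diag f (fapp (F i j) (u j)))) +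
    Re (inner (fapp (F j i) (u i)) (mul_diag f (u j))) +
    fsumR (fun k => Re (inner (fapp (F (Some k) i) (u i)) (mul_diag f (fapp (F (Some k) j) (u j)))))))
  <= K * (1 + 2 * fsumR (fun c => Cnorm2 (alpha c))) * fsumR (fun i => Q (u i)).
Proof.
have z k c w : fapp (F (Some k) (Some c)) w = @vzero _ by [].
rewrite !fsumR_option.
have G := generator_bound.
set A := fsumR (fun c => Cnorm2 (alpha c)) in G *.
have A0 : 0 <= A by apply: fsumR_ge0 => c; exact: Cnorm2_ge0.
have Q0 i : 0 <= Q (u i) by exact: (cutoff_form_ge0 N0 heps M0 hM).
pose B c := Re (inner (u None) (mul_diag f (fapp (F None (Some c)) (u (Some c))))) +
  Re (inner (fapp (F (Some c) None) (u None)) (mul_diag f (u (Some c)))).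
have e1 : fsumR (fun c => Re (inner (u None) (mul_diag f (fapp (F None (Some c)) (u (Some c))))) +
    Re (inner (fapp (F (Some c) None) (u None)) (mul_diag f (u (Some c)))) +
    fsumR (fun k => Re (inner (fapp (F (Some k) None) (u None))
       (mul_diag f (fapp (F (Some k) (Some c)) (u (Some c))))))) = fsumR B.
  congr fsumR; apply: functional_extensionality => c.
  have -> : (fun k => Re (inner (fapp (F (Some k) None) (u None))
       (mul_diag f (fapp (F (Some k) (Some c)) (u (Some c)))))) = (fun=> 0).
    by apply: functional_extensionality => k; rewrite z mul_diag_vzero inner_zero_r.
  by rewrite fsumR_zero Rplus_0_r.
rewrite e1.
(* The first column is the complex conjugate of the first row, so it has the same real part; entries
   with two positive indices contribute nothing. *)
have e2 : fsumR (fun c => fsumR (fun j =>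
    Re (inner (u (Some c)) (mul_diag f (fapp (F (Some c) j) (u j)))) +
    Re (inner (fapp (F j (Some c)) (u (Some c))) (mul_diag f (u j))) +
    fsumR (fun k => Re (inner (fapp (F (Some k) (Some c)) (u (Some c)))
       (mul_diag f (fapp (F (Some k) j) (u j))))))) = fsumR B.
  congr fsumR; apply: functional_extensionality => c; rewrite fsumR_option.
  have zk j : fsumR (fun k => Re (inner (fapp (F (Some k) (Some c)) (u (Some c)))
       (mul_diag f (fapp (F (Some k) j) (u j))))) = 0.
    rewrite -[RHS](fsumR_zero (chan n m)); congr fsumR.
    by apply: functional_extensionality => k; rewrite z inner_zero_l.
  have -> : (fun c' => Re (inner (u (Some c)) (mul_diag f (fapp (F (Some c) (Some c')) (u (Some c'))))) +
    Re (inner (fapp (F (Some c') (Some c)) (u (Some c))) (mul_diag f (u (Some c')))) +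
    fsumR (fun k => Re (inner (fapp (F (Some k) (Some c)) (u (Some c)))
       (mul_diag f (fapp (F (Some k) (Some c')) (u (Some c'))))))) = (fun=> 0).
    apply: functional_extensionality => c'.
    by rewrite zk !z mul_diag_vzero inner_zero_r inner_zero_l /=; ring.
  rewrite fsumR_zero zk /B !Rplus_0_r Rplus_comm; congr (_ + _).
    by rewrite Re_inner_sym -inner_diag.
  by rewrite Re_inner_sym -inner_diag.
rewrite e2.
have hB : fsumR B <= K / 2 * (A * Q (u None) + fsumR (fun c => Q (u (Some c)))).
  apply: (@Rle_trans _ (fsumR (fun c => K / 2 * (Q (u None) * Cnorm2 (alpha c) + Q (u (Some c)))))).
    by apply: fsumR_le => c; have := noise_bound c; rewrite -/(B c); lra.
  by rewrite fsumR_scal fsumR_add fsumR_scal -/A (Rmult_comm A); right.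
have S0 : 0 <= fsumR (fun c => Q (u (Some c))) by apply: fsumR_ge0 => c; exact: Q0.
set S := fsumR (fun c => Q (u (Some c))) in S0 hB *.
have KAS : 0 <= K * (A * S) by apply: Rmult_le_pos => //; exact: Rmult_le_pos.
have KQ : 0 <= K * Q (u None) by apply: Rmult_le_pos.
have -> : K * (1 + 2 * A) * (Q (u None) + S) =
  K * Q (u None) + 2 * (K * (A * S)) + K * (A * Q (u None)) + K * (A * Q (u None) + S) by ring.
by lra.
Qed.

End Estimate.

Theorem mainTheorem8 (n m : nat) (hn : (0 < n)%N) (hm : (0 < m)%N)
  (ws : 'I_n -> R) (wp : 'I_m -> R)
  (hws : forall i, 0 < ws i) (hwp : forall j, 0 < wp j)
  (g : R) (hg : g <> 0) (alpha : chan n m -> Cx)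
  (hsum : fsumR ws = fsumR wp) :
  exists delta b1 b2 : R, 0 < delta /\ 0 <= b1 /\ 0 <= b2 /\
  (* (0) *)
  (forall u, inDomChalf ws wp u -> inDomF ws wp g alpha u) /\
  (* (a) *)
  (forall eps, 0 < eps < delta ->
     (forall u, inD u -> inD (mul_diag (fun x => sqrt (Cepsval ws wp eps x)) u)) /\
     (forall i j, exists M : R, forall u, inD u ->
        let v := mul_diag (fun x => sqrt (Cepsval ws wp eps x)) u in
        dom (adjoint (Fop ws wp g alpha i j)) v /\
        norm (app (adjoint (Fop ws wp g alpha i j)) v) <= M * norm u)) /\
  (* (b) *)
  (forall eps, 0 < eps < delta ->
     forall u : option (chan n m) -> Vec (Idx n m),
       (forall i, inDomF ws wp g alpha (u i)) ->
       Re (lhsB ws wp g alpha eps u) <=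
       fsumR (fun i => b1 * Re (inner (u i) (mul_diag (Cepsval ws wp eps) (u i)))
                       + b2 * norm (u i) ^ 2)).
Proof.
pose p := (2 * (n + m))%N.
have hp : (n + m <= p)%N by rewrite /p mul2n -addnn leq_addr.
have hp2 : (2 <= p)%N by rewrite /p -[X in (X <= _)%N]muln1 leq_pmul2l // addn_gt0 hn.
have N0 := Nval_ge0 hws hwp.
have rep i j := Fop_represents hws hwp hsum g alpha hp hp2 i j.
have [K [K0 hK]] : exists K, 0 <= K /\ forall c, forall eps, 0 < eps < 1 ->
    slow (Nval ws wp) p eps (chan_shift (n := n) (m := m) c) K.
  apply: uniform_constant => [c K K' le h eps he x cx|c].
    have [h1 h2] := h eps he x cx.
    have f0 := cutoff_ge0 p N0 he.
    by split; [apply: Rle_trans h1 _ | apply: Rle_trans h2 _];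
      apply: Rmult_le_compat_r => //; [have := f0 x | have := f0 (sg (chan_shift c) x)]; lra.
  by have [d gc] := graded_chan_shift hws hwp c; exact: (graded_slow N0 p gc).
pose b := K * (1 + 2 * fsumR (fun c => Cnorm2 (alpha c))).
have b0 : 0 <= b.
  apply: Rmult_le_pos => //.
  by have := fsumR_ge0 (fun c => Cnorm2_ge0 (alpha c)); lra.
have C0' x : 0 <= Cval ws wp x by exact: pow_le.
(* [delta = 1] is the range of [eps] in the slow variation estimate; the two constants agree because
   [cutoff_form] weighs its two parts equally. *)
exists 1, b, b; split; first lra; split=> //; split=> //; split; [|split].
- move=> u [h1 h2] i j; have [_ _ h _] := rep i j; apply: h.
  (* From [(1 + N)^p <= 2^p (1 + C)], a vector in Dom([C^(1/2)]) lies in the weighted space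
     contained in every domain. *)
  have T0 : 0 <= 2 ^ p by apply: pow_le; lra.
  apply: sums_bounded_le (sums_bounded_scal T0 (sums_bounded_add h1 h2)) => x.
  rewrite /mul_diag Cnorm2_mul Cnorm2_CofR sqrt_sqrt //.
  have -> : 2 ^ p * (Cnorm2 (u x) + Cval ws wp x * Cnorm2 (u x)) =
    2 ^ p * (1 + Cval ws wp x) * Cnorm2 (u x) by ring.
  by apply: Rmult_le_compat_r; [exact: Cnorm2_ge0 | exact: pow_one_plus_le].
- move=> eps he; split=> [u|i j]; first exact: inD_mul_diag.
  have [M [M0 hM]] := damp_bounded p he.
  have [gF _ _ hadj] := rep i j.
  have [K' [K0' hK']] := fapp_bound N0 (all_graded_fadj N0 gF).
  (* [K'] bounds the squared norm of the image by the weight [(1 + N)^p], and [M] bounds that weight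
     times [C_eps], the square of the multiplier in [v]. *)
  exists (sqrt (K' * M)) => u hu v.
  have hv : inD v by exact: inD_mul_diag.
  have [d1 ->] := hadj _ hv; split=> //.
  have [h1 h2] := hK' v (weighted_inD N0 p hv).
  have KM : 0 <= K' * M by exact: Rmult_le_pos.
  rewrite /norm -sqrt_mult //; last by apply: psum_ge0; exact: inL2_inD.
  apply: sqrt_le_1_alt; apply: Rle_trans h2 _.
  rewrite Rmult_assoc; apply: Rmult_le_compat_l => //.
  have hu2 := inL2_inD hu.
  rewrite -psum_scal //; apply: psum_le; last exact: sums_bounded_scal.
  move=> x; rewrite /v /mul_diag Cnorm2_mul Cnorm2_CofR sqrt_sqrt; last exact: (cutoff_ge0 p N0 he).
  rewrite -Rmult_assoc Rmult_comm (Rmult_comm M); apply: Rmult_le_compat_l; first exact: Cnorm2_ge0.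
  by rewrite Rmult_comm; exact: hM.
move=> eps he u hu.
have [M [M0 hM]] := damp_bounded p he.
have R i j : [/\ inL2 (u j), inL2 (fapp (fop_F ws wp g alpha i j) (u j))
    & app (Fop ws wp g alpha i j) (u j) = fapp (fop_F ws wp g alpha i j) (u j)].
  by have [_ h _ _] := rep i j; apply: h; exact: hu.
have L2u i : inL2 (u i) by case: (R None i).
have L2F i j : inL2 (fapp (fop_F ws wp g alpha i j) (u j)) by case: (R i j).
have E i j : app (Fop ws wp g alpha i j) (u j) = fapp (fop_F ws wp g alpha i j) (u j).
  by case: (R i j).
have QB := quadratic_form_bound hws hwp hsum hp hp2 he M0 hM K0 (fun c => hK c eps he) L2u L2F.
rewrite -/b in QB.
apply: (@Rle_trans _ (b * fsumR (fun i => cutoff_form (Nval ws wp) p eps (u i)))).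
  apply: Rle_trans QB; right; rewrite /lhsB Re_fsumC; congr fsumR.
  apply: functional_extensionality => i; rewrite Re_fsumC; congr fsumR.
  apply: functional_extensionality => j.
  rewrite -[Re (Cadd (Cadd _ _) _)]/(Re _ + Re _ + Re _) Re_fsumC !E; congr (_ + _ + _).
  by congr fsumR; apply: functional_extensionality => k; rewrite !E.
rewrite -fsumR_scal; apply: fsumR_le => i.
by rewrite (cutoff_formE N0 he M0 hM (L2u i)) Rmult_plus_distr_l; right.
Qed.
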